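(* Let $b_1\in(0,\infty)$, $b_2\in(b_1,\infty)$, and $m>2$. Fix $\lambda_1,\lambda_1'\in(1,\infty)$ and $\lambda_2,\lambda_2'\in(0,\infty)$. Let a sequence $P_n\in\mathcal{P}(b_1,b_2,m)$ and a subsequence $n'$ of $n$ be given such that, writing $d'=d_{n'}$, one has $d'\geq2$, $$\sqrt{n'\log(d')}\,\overline{\eta}_{n'}^{1-\frac1m}\to0\quad\text{and}\quad\log(d')/{n'}^{\frac{m-2}{5m-2}}\to0,$$ and $$\sqrt{n'\log(d')}\,\mathfrak{d}(n',d',m,\overline{\eta}_{n'})\,\|\mu_{n'}(P_{n'})\|_\infty\to c\in(0,\infty].$$ Then, for every sequence $\mathcal{H}_n^*$ satisfying $\emptyset\neq\mathcal{H}_n^*\subseteq\mathcal{H}_n$ along $n'$ and such that $$r_{n'}:=\sup\left\{\|x\|_\infty:x\in H,\ H\in\mathcal{H}^*_{n'}\right\}=O\left(\sqrt{\log(d')}\right),$$ it holds that $$\sup_{H\in\mathcal{H}^*_{n'}}\left|P_{n'}\left(S_{n',W}\in H\right)-P_{n'}\left(\Sigma_{0,n'}^{1/2}(P_{n'})Z_{d'}+\sqrt{n'}D_{n'}^{-1}(P_{n'})\mu_{n'}(P_{n'})\in H\right)\right|\to0;$$ more generally, for every sequence $H_n$ such that $H_n\in\mathcal{H}_n^*$ along $n'$, we then have $$P_{n'}\left(S_{n',W}\in H_{n'}\right)\to0\quad\text{and}\quad P_{n'}\left(\Sigma_{0,n'}^{1/2}(P_{n'})Z_{d'}+\sqrt{n'}D_{n'}^{-1}(P_{n'})\mu_{n'}(P_{n'})\in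 H_{n'}\right)\to0.$$
   Context: Setting. $(\Omega,\mathcal{F})$ is a measurable space and $(d_n)$ a sequence of positive integers; we write $d=d_n$. For every $n\in\mathbb{N}$ there are random vectors $X_{1,n},\ldots,X_{n,n}:\Omega\to\mathbb{R}^d$ (uncontaminated observations; $X_{i,n,j}$ is the $j$-th coordinate of $X_{i,n}$), $\tilde X_{1,n},\ldots,\tilde X_{n,n}:\Omega\to\mathbb{R}^d$ (potentially contaminated observations, with coordinates $\tilde X_{i,n,j}$), and $Z_d:\Omega\to\mathbb{R}^d$. Throughout, $|\{i\in\{1,\ldots,n\}:\tilde X_{i,n}\neq X_{i,n}\}|\le\overline{\eta}_nn$ with $\overline{\eta}_n\in[0,1/2)$ non-random; the contamination is otherwise arbitrary. For a probability measure $P$ on $\mathcal{F}$ with expectation $E_P$: $\mu_n(P)=E_PX_{1,n}$ with coordinates $\mu_{n,j}(P)$; $\Sigma_n(P)$ is the covariance matrix of $X_{1,n}$ under $P$; $\sigma_{m,n,j}^m(P)=E_P|X_{1,n,j}-\mu_{n,j}(P)|^m$ for $m\in[2,\infty)$; $D_n(P)=\mathrm{diag}(\sigma_{2,n,1}(P),\ldots,\sigma_{2,n,d}(P))$; $\Sigma_{0,n}(P)=D_n^{-1}(P)\Sigma_n(P)D_n^{-1}(P)$ is the correlation matrix. $A^{1/2}$ is the symmetric positive semi-definite square root of a symmetric positive semi-definite matrix $A$. $\mathcal{P}(b_1,b_2,m)$ is the set of probability measures $P$ on $\mathcal{F}$ satisfying for every $n\in\mathbb{N}$: (i) $X_{1,n},\ldots,X_{n,n}$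 are i.i.d.; (ii) $E_P|X_{1,n,j}|^m<\infty$ for $j=1,\ldots,d$; (iii) $b_1\le\min_{j}\sigma_{2,n,j}(P)$ and $\max_j\sigma_{m,n,j}(P)\le b_2$; (iv) $Z_d\sim\mathsf{N}_d(0_d,I_d)$ is independent of $(X_{1,n},\ldots,X_{n,n},\tilde X_{1,n},\ldots,\tilde X_{n,n})$. $\mathcal{H}_n$ is the class of all sets $\{x\in\mathbb{R}^d:a_j\le x_j\le b_j\text{ for all }j=1,\ldots,d\}$ with $-\infty\le a_j\le b_j\le\infty$. Winsorized statistic. For reals $x_1,\ldots,x_n$ let $x_1^*\le\cdots\le x_n^*$ be their non-decreasing rearrangement; thus $\tilde X_{k,n,j}^*$ is the $k$-th order statistic of $\tilde X_{1,n,j},\ldots,\tilde X_{n,n,j}$. For $-\infty<u\le v<\infty$ let $\phi_{u,v}(x)=u$ if $x<u$, $=x$ if $x\in[u,v]$, $=v$ if $x>v$. Let $\varepsilon_n=\lambda_1\overline{\eta}_n+\lambda_2\frac{\log(dn)}{n}$ and $\varepsilon_n'=\lambda_1'\overline{\eta}_n+\lambda_2'\frac{\log(d^2n)}{n}$ (under the conditions of the claim both are eventually in $(0,1/2)$ along $n'$). Put $\hat\alpha_j=\tilde X^*_{\lceil\varepsilon_nn\rceil,n,j}$, $\hat\beta_j=\tilde X^*_{\lceil(1-\varepsilon_n)n\rceil,n,j}$, $\hat a_j=\tilde X^*_{\lceil\varepsilon_n'n\rceil,n,j}$, $\hat b_j=\tilde X^*_{\lceil(1-\varepsilon_n')n\rceil,n,j}$,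 $\tilde\mu_{n,j}=\frac1n\sum_{i=1}^n\phi_{\hat a_j,\hat b_j}(\tilde X_{i,n,j})$, and let $\tilde\Sigma_n$ be the $d\times d$ matrix with entries $$\tilde\Sigma_{n,j,k}=\frac1n\sum_{i=1}^n\left[\phi_{\hat a_j,\hat b_j}(\tilde X_{i,n,j})-\tilde\mu_{n,j}\right]\left[\phi_{\hat a_k,\hat b_k}(\tilde X_{i,n,k})-\tilde\mu_{n,k}\right].$$ Let $\tilde\sigma_{n,j}=\tilde\Sigma_{n,j,j}^{1/2}$. Then $S_{n,W}\in\mathbb{R}^d$ has coordinates $S_{n,W,j}=\frac{1}{\sqrt n\,\tilde\sigma_{n,j}}\sum_{i=1}^n\phi_{\hat\alpha_j,\hat\beta_j}(\tilde X_{i,n,j})$, left undefined (no particular value prescribed) if $\tilde\sigma_{n,j}=0$. Rate. With $x\wedge y=\min(x,y)$, $\mathfrak{d}(n,d,m,\overline{\eta}_n)=\overline{\eta}_n^{1-\frac2m}+\left(\frac{\log(dn)}{n}\right)^{1-\frac{1}{(m/2)\wedge2}}$. *)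

(* Defs.v *)
From HB Require Import structures.
From mathcomp Require Import all_boot all_order all_algebra.
From mathcomp Require Import all_classical all_reals all_analysis.

Set Implicit Arguments.
Unset Strict Implicit.
Unset Printing Implicit Defensive.
Import Order.TTheory GRing.Theory Num.Theory.
Import numFieldNormedType.Exports.
Local Open Scope classical_set_scope.
Local Open Scope ring_scope.

(* Random vectors take values in [k.-tuple R], which carries the product Borel
   sigma-algebra; [vec] moves them to column vectors, whose norm [`|_|] is the
   supremum norm.

   A triangular array is a function [X] of [n] and [i : nat] in which only the
   entries with [0 < n] and [1 <= i <= n] are meaningful. *)

Definition rvec disp (Omega : measurableType disp) (R : realType) (k : nat) :=
  {mfun Omega >-> k.-tuple R}.

Definition vec (R : realType) (k : nat) (t : k.-tuple R) : 'cV[R]_k :=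
  \col_j tnth t j.

Section Probability.
Context disp (Omega : measurableType disp) (R : realType).
Implicit Type P : probability Omega R.

Definition mutually_independent d' (T' : measurableType d') (I : finType) P
    (Y : I -> Omega -> T') : Prop :=
  forall (J : {set I}) (B : I -> set T'), (forall i, measurable (B i)) ->
    P (\bigcap_(i in [set` J]) Y i @^-1` B i)
      = \big[*%E/1%E]_(i in J) P (Y i @^-1` B i).

Definition independent d1 d2 (T1 : measurableType d1) (T2 : measurableType d2) P
    (Y1 : Omega -> T1) (Y2 : Omega -> T2) : Prop :=
  forall (B1 : set T1) (B2 : set T2), measurable B1 -> measurable B2 ->
    P (Y1 @^-1` B1 `&` Y2 @^-1` B2)
      = (P (Y1 @^-1` B1) * P (Y2 @^-1` B2))%E.

Definition iid k P n (Y : nat -> rvec Omega R k) : Prop :=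
  mutually_independent P (fun i : 'I_n => Y i.+1 : Omega -> k.-tuple R) /\
  forall i, (1 <= i <= n)%N -> forall B : set (k.-tuple R), measurable B ->
    distribution P (Y i) B = distribution P (Y 1%N) B.

(* N_k(0, I_k) is the k-fold product of the law N(0, 1). *)
Definition std_gaussian k P (Z : rvec Omega R k) : Prop :=
  mutually_independent P (fun (j : 'I_k) w => tnth (Z w) j) /\
  forall (j : 'I_k) (B : set R), measurable B ->
    P [set w | B (tnth (Z w) j)] = normal_prob 0 1 B.

Definition mean k P (Y : rvec Omega R k) : 'cV[R]_k :=
  \col_j fine 'E_P[fun w => tnth (Y w) j]%E.

Definition covmx k P (Y : rvec Omega R k) : 'M[R]_k :=
  \matrix_(i, j)
    fine (covariance P (fun w => tnth (Y w) i) (fun w => tnth (Y w) j)).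

(* sigma_{m,j}, i.e. (E |Y_j - E Y_j| ^ m) ^ (1 / m) *)
Definition cmoment k P (Y : rvec Omega R k) (m : R) (j : 'I_k) : R :=
  fine 'E_P[fun w => (`|tnth (Y w) j - mean P Y j 0| `^ m)%R]%E `^ m^-1.

Definition sdmx k P (Y : rvec Omega R k) : 'M[R]_k :=
  diag_mx (\row_j cmoment P Y 2 j).

Definition cormx k P (Y : rvec Omega R k) : 'M[R]_k :=
  invmx (sdmx P Y) *m covmx P Y *m invmx (sdmx P Y).

Definition model_class (d : nat -> nat)
    (X Xt : forall n : nat, nat -> rvec Omega R (d n))
    (Z : forall k : nat, rvec Omega R k) (b1 b2 m : R) P : Prop :=
  forall n, (0 < n)%N ->
  [/\ iid P n (X n),
      forall j, ('E_P[fun w => (`|tnth (X n 1%N w) j| `^ m)%R] < +oo)%E,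
      (forall j, b1 <= cmoment P (X n 1%N) 2 j) /\
      (forall j, cmoment P (X n 1%N) m j <= b2),
      std_gaussian P (Z (d n)) &
      independent P (Z (d n))
        (fun w => ([tuple X n i.+1 w | i < n], [tuple Xt n i.+1 w | i < n]))].

End Probability.

Section Deterministic.
Context (R : realType).

Definition psd k (A : 'M[R]_k) : Prop :=
  A^T = A /\ forall x : 'cV[R]_k, 0 <= (x^T *m A *m x) 0 0.

(* The positive semi-definite square root; 0 if there is none, that is, if [A]
   is not positive semi-definite. *)
Definition sqrtmx k (A : 'M[R]_k) : 'M[R]_k :=
  xget 0 [set B | psd B /\ B *m B = A].

Definition hyperrectangle k : set (set 'cV[R]_k) :=
  [set H : set 'cV[R]_k | exists a b : 'I_k -> \bar R, (forall j, (a j <= b j)%E) /\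
     H = [set x : 'cV[R]_k | forall j, (a j <= (x j 0)%:E <= b j)%E]].

(* The [k]-th order statistic of [s], for [1 <= k <= size s]. *)
Definition order_stat (s : seq R) (k : nat) : R := nth 0 (sort <=%R s) k.-1.

Definition ceiln (x : R) : nat := `|Num.ceil x|%N.

Definition phi (u v x : R) : R :=
  if x < u then u else if x <= v then x else v.

Definition winsor (e : R) (s : seq R) (x : R) : R :=
  phi (order_stat s (ceiln (e * (size s)%:R)))
      (order_stat s (ceiln ((1 - e) * (size s)%:R))) x.

Definition coords k n (x : nat -> k.-tuple R) (j : 'I_k) : seq R :=
  [seq tnth (x i) j | i <- index_iota 1 n.+1].

Definition wmean e k n (x : nat -> k.-tuple R) (j : 'I_k) : R :=
  n%:R^-1 * \sum_(1 <= i < n.+1) winsor e (coords n x j) (tnth (x i) j).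

Definition wcov e k n (x : nat -> k.-tuple R) : 'M[R]_k :=
  \matrix_(j, l) (n%:R^-1 * \sum_(1 <= i < n.+1)
     (winsor e (coords n x j) (tnth (x i) j) - wmean e n x j) *
     (winsor e (coords n x l) (tnth (x i) l) - wmean e n x l)).

Definition wsd e k n (x : nat -> k.-tuple R) (j : 'I_k) : R :=
  Num.sqrt (wcov e n x j j).

(* [t] is a value of S_{n,W} on the sample [x 1, ..., x n], with levels [e] for
   the numerator and [e'] for the normalization; coordinates with zero
   normalization are unconstrained. *)
Definition winsorized_stat e e' k n (x : nat -> k.-tuple R) (t : k.-tuple R) :
    Prop :=
  forall j, wsd e' n x j != 0 ->
    tnth t j = (Num.sqrt n%:R * wsd e' n x j)^-1 *
      \sum_(1 <= i < n.+1) winsor e (coords n x j) (tnth (x i) j).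

Definition eps (l1 l2 eta : R) (d n : nat) : R :=
  l1 * eta + l2 * (ln (d * n)%:R / n%:R).

Definition eps' (l1 l2 eta : R) (d n : nat) : R :=
  l1 * eta + l2 * (ln (d ^ 2 * n)%:R / n%:R).

Definition rate (n d : nat) (m eta : R) : R :=
  eta `^ (1 - 2 / m) +
  (ln (d * n)%:R / n%:R) `^ (1 - (Num.min (m / 2) 2)^-1).

End Deterministic.

(* Main.v *)
Require Import Defs.
From HB Require Import structures.
From mathcomp Require Import all_boot all_order all_algebra.
From mathcomp Require Import all_classical all_reals all_analysis.
Set Implicit Arguments.
Unset Strict Implicit.
Unset Printing Implicit Defensive.
Import Order.TTheory GRing.Theory Num.Theory.
Import numFieldNormedType.Exports.
Local Open Scope classical_set_scope.
Local Open Scope ring_scope.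
From mathcomp Require Import measurable_realfun zify ring lra.

(** Only the coordinate [j] with [|mu_j| = ||mu||_oo] matters: the rate conditions
    give [sqrt n |mu_j| / sqrt (log d) -> oo], so it suffices that coordinate [j]
    of each of the two vectors stays within O_P(1) of a drift of order
    [sqrt n |mu_j|], hence leaves every box of radius O(sqrt (log d)).
    For the Gaussian vector this is Chebyshev's inequality.
    For the winsorized statistic there is a deterministic bound on the event that
    the m-th empirical moment of the clean sample [Y] is at most [K]: more than
    [(e - eta) n] clean observations cannot exceed the level [T] with
    [T ^ m ~ K / e], so the winsorization thresholds lie in [mu - T, mu + T], and
    all but [3 e n] winsorized values equal the clean ones. The winsorized sum
    then differs from the clean one by at most [n] times a constant multiple of
    [e ^ (1 - 1/m)], which is [o (sqrt n)], and the winsorized standard deviation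
    is bounded. It is nonzero because at most [3 e' n] clean observations could
    differ from a common value, whereas a positive proportion of them lies on
    either side of [mu]. *)

(** * Winsorization of a contaminated sample *)

(** The space is fixed, but law and dimension vary with the index, so the constants [p0] and [V] are
    chosen before any probability space is introduced: [p0] depends only on [m], [b1], [b2], and [V]
    on nothing. The drift condition is best read as a product: sqrt(n log d) rate |mu| = (sqrt n
    |mu| / sqrt(log d)) (rate log d). The last factor tends to 0 while the product stays above a
    positive constant, so the first factor diverges. The exponent (m - 2) / (5m - 2) enters through
    comparisons of powers of n, here and for sqrt n e ^ (1 - 1/m). Since [lam1] and [lam1'] exceed
    1, both levels satisfy e - eta >= kap e with a fixed kap > 0. Without such a margin the e n
    extreme observations could all be contaminated, and nothing would bound the thresholds. Given
    it, T of order e ^ (-1/m) balances the two error terms e T and T ^ (1 - m), both of order e ^ (1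
    - 1/m). The two probabilities are never compared with each other: each is small, uniformly over
    the sets in [Hs], and the supremum follows from the triangle inequality. *)

Section OrderStat.
Context (R : realType).
Implicit Types (s : seq R) (k : nat).

(** The first [k] entries of the sorted list are witnesses; ties can only enlarge the count, so this
    and the next three bounds are inequalities. *)
Lemma order_stat_count_le s k : (0 < k <= size s)%N ->
  (k <= count (fun x => (x <= order_stat s k)%R) s)%N.
Proof.
move=> /andP[k0 ks]; rewrite -(count_sort <=%R) -(cat_take_drop k (sort _ s)).
rewrite count_cat; apply: leq_trans (leq_addr _ _).
have sz : size (take k (sort <=%R s)) = k by rewrite size_takel // size_sort.
rewrite -[leqLHS]sz; apply: eq_leq; apply/esym/eqP; rewrite -all_count.
apply/(all_nthP 0) => i; rewrite sz => ik; rewrite nth_take //.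
by apply: le_sorted_leq_nth; rewrite ?sort_le_sorted // ?inE ?size_sort /=; lia.
Qed.

(** The witnesses are the sorted entries from position [k] on, the [k]-th included: size s - k + 1
    of them, written without truncated subtraction. *)
Lemma order_stat_count_ge s k : (0 < k <= size s)%N ->
  (size s < count (fun x => (order_stat s k <= x)%R) s + k)%N.
Proof.
move=> /andP[k0 ks].
rewrite -(count_sort <=%R) -(cat_take_drop k.-1 (sort _ s)) count_cat.
have sz : size (drop k.-1 (sort <=%R s)) = (size s - k.-1)%N.
  by rewrite size_drop size_sort.
set c := (X in (_ + X + _)%N).
suff : (size s - k.-1 <= c)%N by lia.
rewrite -[leqLHS]sz; apply: eq_leq; apply/esym/eqP; rewrite -all_count.
apply/(all_nthP 0) => i; rewrite sz => ik; rewrite nth_drop.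
by apply: le_sorted_leq_nth; rewrite ?sort_le_sorted // ?inE ?size_sort /=; lia.
Qed.

Lemma order_stat_count_lt s k : (0 < k <= size s)%N ->
  (count (fun x => (x < order_stat s k)%R) s < k)%N.
Proof.
move=> /order_stat_count_ge; rewrite addnC.
rewrite -(count_predC (fun x => order_stat s k <= x) s) addnC ltn_add2r.
by rewrite (eq_count (a2 := fun x => x < order_stat s k)) // => x /=; rewrite -ltNge.
Qed.

Lemma order_stat_count_gt s k : (0 < k <= size s)%N ->
  (count (fun x => (order_stat s k < x)%R) s <= size s - k)%N.
Proof.
move=> /order_stat_count_le h; rewrite leq_subRL; last first.
  by apply: leq_trans h (count_size _ _).
rewrite -(count_predC (fun x => x <= order_stat s k) s) leq_add //.
by rewrite (eq_count (a2 := predC (fun x => x <= order_stat s k))) // => x /=; rewrite -ltNge.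
Qed.

Lemma order_stat_mem s k : (0 < k <= size s)%N -> order_stat s k \in s.
Proof.
by case: k => // k ks; rewrite -(mem_sort <=%R) mem_nth // size_sort.
Qed.

Lemma order_stat_le s k l : (0 < k)%N -> (k <= l <= size s)%N ->
  order_stat s k <= order_stat s l.
Proof.
move=> k0 /andP[kl ls].
by apply: le_sorted_leq_nth; rewrite ?sort_le_sorted // ?inE ?size_sort /=; lia.
Qed.

Lemma ceiln_itv (x : R) : 0 <= x -> x <= (ceiln x)%:R < x + 1.
Proof.
move=> x0; have /andP[h1 h2] := ceil_itv x.
have c0 : 0 <= Num.ceil x by rewrite ceil_ge0; lra.
have E : (ceiln x)%:R = (Num.ceil x)%:~R :> R.
  by rewrite /ceiln pmulrn gez0_abs.
by rewrite E h2 /=; move: h1; rewrite intrB; lra.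
Qed.

End OrderStat.

(** * Counting and truncation inequalities *)

Lemma sumr_count (R : pzRingType) (I : Type) (r : seq I) (p : pred I) (c : R) :
  \sum_(i <- r | p i) c = (count p r)%:R * c.
Proof.
rewrite -sum1_count natr_sum mulr_suml.
by apply: eq_bigr => i _; rewrite mul1r.
Qed.

Lemma count_le_subset (I : Type) (r : seq I) (p q1 q2 : pred I) :
  (forall i, p i -> q1 i || q2 i) -> (count p r <= count q1 r + count q2 r)%N.
Proof.
move=> h; rewrite -count_predUI; apply: leq_trans (leq_addr _ _).
exact: sub_count.
Qed.

(** Markov's inequality for the empirical measure. *)
Lemma count_moment (R : realType) (I : Type) (r : seq I) (p : pred I)
    (z : I -> R) (T m : R) : 0 <= T -> 0 <= m ->
    (forall i, p i -> T <= `|z i|) ->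
  (count p r)%:R * T `^ m <= \sum_(i <- r) `|z i| `^ m.
Proof.
move=> T0 m0 h; rewrite -sumr_count big_mkcond /=; apply: ler_sum => i _.
case: ifP => [/h Tz|_]; last exact: powR_ge0.
by rewrite ge0_ler_powR // nnegrE.
Qed.

Lemma phi_itv (R : realType) (u v x : R) : u <= v -> u <= phi u v x <= v.
Proof.
move=> uv; rewrite /phi; case: ltP => [_|ux]; first by rewrite lexx uv.
by case: ifPn => xv; apply/andP.
Qed.

Lemma phi_id (R : realType) (u v x : R) : u <= x <= v -> phi u v x = x.
Proof. by move=> /andP[ux xv]; rewrite /phi ltNge ux xv. Qed.

Lemma sqr_le_powR (R : realType) (z m : R) : 2 <= m -> z ^+ 2 <= 1 + `|z| `^ m.
Proof.
move=> m2; rewrite -real_normK ?num_real //.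
have := powR_ge0 `|z| m; case: (leP `|z| 1) => [z1|/ltW z1] zm.
  by have : `|z| ^+ 2 <= 1 by [rewrite expr_le1]; lra.
have := ler_powR z1 m2; rewrite powR_mulrn //; lra.
Qed.

(** Beyond T the factor (|z| / T) ^ (m - 1) is at least 1. The first term will be charged to the few
    bad indices only, the second to all indices through the empirical moment. *)
Lemma norm_le_powR (R : realType) (z T m : R) : 0 < T -> 1 <= m ->
  `|z| <= T + `|z| `^ m / T `^ (m - 1).
Proof.
move=> T0 m1; have Tm := powR_gt0 (m - 1) T0.
have zm := powR_ge0 `|z| m.
case: (leP `|z| T) => [zT|/ltW zT].
  by rewrite (le_trans zT) // lerDl divr_ge0 // ltW.
suff : `|z| <= `|z| `^ m / T `^ (m - 1) by lra.
have m0 : 0 < m by lra.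
have m10 : 0 <= m - 1 by lra.
rewrite ler_pdivlMr // -(mulr_powRB1 (normr_ge0 z)) // ler_wpM2l //.
by rewrite ge0_ler_powR ?nnegrE // ltW.
Qed.

(** * Deterministic bounds for one coordinate, at a generic level [e] *)

Section ContaminatedSample.
Context (R : realType) (I : eqType) (r : seq I) (y yt : I -> R).
Context (mu m e eta K T : R).
Let s := [seq yt i | i <- r].
Let N : R := (size s)%:R.
Let lo := order_stat s (ceiln (e * N)).
Let hi := order_stat s (ceiln ((1 - e) * N)).
Context (r_gt0 : (0 < size r)%N) (e_gt0 : 0 < e) (e_lt : e < 1 / 2) (eta_le : eta <= e).
Context (contam : (count (fun i => yt i != y i) r)%:R <= eta * N).
Context (m_gt2 : 2 < m) (T_ge1 : 1 <= T) (KT : K < T `^ m * (e - eta)).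
Context (moment : \sum_(i <- r) `|y i - mu| `^ m <= K * N).

Let N_gt0 : 0 < N.
Proof. by rewrite /N size_map ltr0n. Qed.

Let lo_idx : (0 < ceiln (e * N) <= size s)%N.
Proof.
move: e_gt0 e_lt => e_gt e_l.
have e0 : 0 < e * N by apply: mulr_gt0 => //; lra.
have /andP[h1 h2] := ceiln_itv (ltW e0).
have : e * N <= N by rewrite ger_pMl //; lra.
rewrite -(ltr0n R) (lt_le_trans e0 h1) /= => eN.
rewrite -ltnS -(ltr_nat R); apply: lt_le_trans h2 _.
by rewrite -natr1 lerD2r.
Qed.

Let hi_idx : (0 < ceiln ((1 - e) * N) <= size s)%N.
Proof.
move: e_gt0 e_lt => e_gt e_l.
have e0 : 0 < (1 - e) * N by apply: mulr_gt0 => //; lra.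
have /andP[h1 h2] := ceiln_itv (ltW e0).
have : (1 - e) * N <= N by rewrite ger_pMl //; lra.
rewrite -(ltr0n R) (lt_le_trans e0 h1) /= => eN.
rewrite -ltnS -(ltr_nat R); apply: lt_le_trans h2 _.
by rewrite -natr1 lerD2r.
Qed.

Let lo_le_hi : lo <= hi.
Proof.
move: e_gt0 e_lt => e_gt e_l.
apply: order_stat_le; first by case/andP: lo_idx.
case/andP: hi_idx => _ ->; rewrite andbT.
rewrite -ltnS -(ltr_nat R).
have e0 : 0 <= e * N by apply: mulr_ge0; [lra|exact: ltW].
have e1 : 0 <= (1 - e) * N by apply: mulr_ge0; [lra|exact: ltW].
have /andP[_ h2] := ceiln_itv e0; have /andP[h1 _] := ceiln_itv e1.
apply: lt_le_trans h2 _; rewrite -natr1 lerD2r; apply: le_trans h1.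
by rewrite ler_pM2r //; lra.
Qed.

(** Of e N observations in [p] at most eta N are contaminated, so (e - eta) N clean ones lie at
    distance at least T from [mu]. By Markov's inequality their m-th moments exceed K N; [KT] is
    exactly what makes this contradictory. *)
Let count_y_contradiction (p q : pred I) :
  (forall i, p i -> yt i != y i \/ q i) -> (forall i, q i -> T <= `|y i - mu|) ->
  e * N <= (count p r)%:R -> False.
Proof.
move: m_gt2 T_ge1 contam => m2 T1 cont.
move=> pq qT ep.
have T0 : 0 <= T by lra.
have m0 : 0 <= m by lra.
have := count_moment r T0 m0 qT.
have : (count p r <= count (fun i => yt i != y i) r + count q r)%N.
  by apply: count_le_subset => i /pq [->//|->]; rewrite orbT.
rewrite -(ler_nat R) natrD => c1 c2.
have c3 : (e - eta) * N <= (count q r)%:R by rewrite mulrBl; lra.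
have Tm0 : 0 <= T `^ m by exact: powR_ge0.
have : T `^ m * (e - eta) * N <= K * N.
  apply: le_trans moment; apply: le_trans c2.
  by rewrite -mulrA mulrC ler_wpM2r.
by rewrite ler_pM2r // leNgt KT.
Qed.

Let lo_ge : mu - T <= lo.
Proof.
move: e_gt0 e_lt T_ge1 => e_gt e_l T1.
rewrite leNgt; apply/negP => h.
apply: (@count_y_contradiction (fun i => yt i <= lo) (fun i => y i <= lo)).
- move=> i; case: (eqVneq (yt i) (y i)) => [->|]; first by right.
  by left.
- by move=> i yi; rewrite ler0_norm; lra.
- have := order_stat_count_le lo_idx; rewrite count_map -(ler_nat R).
  apply: le_trans.
  have e0 : 0 <= e * N by apply: mulr_ge0; [lra|exact: ltW].
  by case/andP: (ceiln_itv e0).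
Qed.

Let hi_le : hi <= mu + T.
Proof.
move: e_gt0 e_lt T_ge1 => e_gt e_l T1.
rewrite leNgt; apply/negP => h.
apply: (@count_y_contradiction (fun i => hi <= yt i) (fun i => hi <= y i)).
- move=> i; case: (eqVneq (yt i) (y i)) => [->|]; first by right.
  by left.
- by move=> i yi; rewrite ger0_norm; lra.
(* The off-by-one absorbs the ceiling: with k = ceil((1 - e) N) < (1 - e) N + 1, at least N - k + 1
   > e N observations are above [hi]. *)
- have := order_stat_count_ge hi_idx; rewrite count_map -(ler_nat R) -natr1 natrD => c1.
  have e0 : 0 <= (1 - e) * N by apply: mulr_ge0; [lra|exact: ltW].
  have /andP[_ c2] := ceiln_itv e0.
  have -> : e * N = N - (1 - e) * N by ring.
  by rewrite -/N in c1; lra.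
Qed.

(* Winsorization leaves every other index at its clean value. *)
Let bad i := [|| yt i != y i, yt i < lo | hi < yt i].

(** One share of e N for each way of being bad: contaminated (eta <= e), below [lo], above [hi]. *)
Let count_bad : (count bad r)%:R <= 3 * e * N.
Proof.
move: e_gt0 e_lt eta_le contam => e_gt e_l eta_l cont.
have c1 : (count bad r)%:R <= (count (fun i => yt i != y i) r)%:R
    + (count (fun i => yt i < lo) r)%:R + (count (fun i => hi < yt i) r)%:R :> R.
  rewrite -!natrD ler_nat.
  apply: leq_trans (count_le_subset r (q1 := fun i => yt i != y i)
    (q2 := fun i => (yt i < lo) || (hi < yt i)) _) _ => //.
  rewrite -addnA leq_add2l.
  exact: count_le_subset.
have c2 : (count (fun i => yt i < lo) r)%:R <= e * N.
  have := order_stat_count_lt lo_idx; rewrite count_map -(ler_nat R) -natr1.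
  have e0 : 0 <= e * N by apply: mulr_ge0; [lra|exact: ltW].
  have /andP[_ c3] := ceiln_itv e0; rewrite -/lo -/N.
  by move=> c4; move: (le_lt_trans c4 c3); rewrite ltrD2r => /ltW.
have c3 : (count (fun i => hi < yt i) r)%:R <= e * N.
  have := order_stat_count_gt hi_idx; rewrite count_map -(ler_nat R).
  have e0 : 0 <= (1 - e) * N by apply: mulr_ge0; [lra|exact: ltW].
  have /andP[c3 _] := ceiln_itv e0; rewrite natrB; last by case/andP: hi_idx.
  rewrite -/N => /le_trans; apply.
  have -> : e * N = N - (1 - e) * N by ring.
  by rewrite lerD2l lerN2.
have c4 : eta * N <= e * N by rewrite ler_wpM2r // ltW.
have -> : 3 * e * N = e * N + e * N + e * N by ring.
lra.
Qed.

Let W x := winsor e s x.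

Let W_dist x : `|W x - mu| <= T.
Proof.
have /andP[h1 h2] := phi_itv x lo_le_hi; have := lo_ge; have := hi_le.
by rewrite ler_distl /W /winsor -/N -/lo -/hi => h3 h4; apply/andP; split; lra.
Qed.

Let W_good i : ~~ bad i -> W (yt i) = y i.
Proof.
rewrite /bad !negb_or negbK -!leNgt => /and3P[/eqP <- h1 h2].
by apply: phi_id; rewrite h1 h2.
Qed.

(** Only bad indices contribute. There the winsorized value is within T of [mu], and |y i - mu| is
    at most T plus a tail term by [norm_le_powR]: 2 T for each of at most 3 e N indices, hence 6 e
    T. *)
Lemma winsorized_sum_dist :
  `|\sum_(i <- r) winsor e s (yt i) - \sum_(i <- r) y i|
    <= N * (6 * e * T + K / T `^ (m - 1)).
Proof.
move: e_gt0 m_gt2 T_ge1 => e_gt m2 T1.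
have T0 : 0 < T by lra.
have Tm := powR_gt0 (m - 1) T0.
rewrite -sumrB; apply: le_trans (ler_norm_sum _ _ _) _.
apply: (@le_trans _ _ (\sum_(i <- r | bad i) (2 * T) +
    \sum_(i <- r) `|y i - mu| `^ m / T `^ (m - 1))).
  rewrite [X in X + _]big_mkcond -big_split /=; apply: ler_sum => i _.
  case: ifPn => [_|/W_good]; last first.
    rewrite /W => ->.
    by rewrite subrr normr0 add0r divr_ge0 ?powR_ge0.
  have := W_dist (yt i); rewrite distrC /W => h1.
  have m1 : 1 <= m by lra.
  have := norm_le_powR (y i - mu) T0 m1.
  have -> : winsor e s (yt i) - y i = - (y i - mu) - (mu - winsor e s (yt i)).
    by ring.
  have := ler_normB (- (y i - mu)) (mu - winsor e s (yt i)).
  rewrite normrN; lra.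
rewrite sumr_count -mulr_suml.
have h1 : (count bad r)%:R * (2 * T) <= 3 * e * N * (2 * T).
  by rewrite ler_pM2r //; lra.
have h2 : (\sum_(i <- r) `|y i - mu| `^ m) / T `^ (m - 1)
    <= K * N / T `^ (m - 1).
  by rewrite ler_pM2r // invr_gt0.
have -> : N * (6 * e * T + K / T `^ (m - 1)) =
  3 * e * N * (2 * T) + K * N / T `^ (m - 1) by ring.
by rewrite lerD.
Qed.

(** Bad indices cost at most T ^ 2 each; at the others the clean square is dominated by 1 plus the
    m-th power. This controls the winsorized variance. *)
Lemma winsorized_sum_sqr :
  \sum_(i <- r) (winsor e s (yt i) - mu) ^+ 2 <= N * (3 * e * T ^+ 2 + 1 + K).
Proof.
move: T_ge1 => T1.
apply: (@le_trans _ _ (\sum_(i <- r | bad i) T ^+ 2 +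
    (\sum_(i <- r) 1 + \sum_(i <- r) `|y i - mu| `^ m))).
  rewrite [X in X + _]big_mkcond -!big_split /=; apply: ler_sum => i _.
  case: ifPn => [_|/W_good].
    have := powR_ge0 `|y i - mu| m.
    have : (winsor e s (yt i) - mu) ^+ 2 <= T ^+ 2.
      have := W_dist (yt i); rewrite /W => Wd.
      have T0 : 0 <= T by lra.
      by rewrite -real_normK ?num_real // ler_sqr ?nnegrE.
    lra.
  rewrite /W => ->; rewrite add0r.
  by apply: sqr_le_powR; exact: ltW.
rewrite !sumr_count count_predT mulr1.
have h1 : (count bad r)%:R * T ^+ 2 <= 3 * e * N * T ^+ 2.
  by rewrite ler_wpM2r // sqr_ge0.
have -> : N * (3 * e * T ^+ 2 + 1 + K) = 3 * e * N * T ^+ 2 + (N + K * N) by ring.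
by rewrite lerD // lerD // /N size_map.
Qed.

(** [lo] and [hi] are themselves observations fixed by winsorization, so both equal [q], and so does
    every clean value at a good index. The side of [mu] that does not contain [q] then consists of
    bad indices only. *)
Lemma winsorized_constant q : (forall i, i \in r -> winsor e s (yt i) = q) ->
  (count (fun i => mu < y i) r)%:R <= 3 * e * N \/
  (count (fun i => y i <= mu) r)%:R <= 3 * e * N.
Proof.
move=> Wq.
have loq : lo = q.
  have /mapP[i ir E] : lo \in s by exact: order_stat_mem.
  rewrite -(Wq i ir) -E /winsor -/N -/lo -/hi phi_id // lexx /=.
  exact: lo_le_hi.
have hiq : hi = q.
  have /mapP[i ir E] : hi \in s by exact: order_stat_mem.
  rewrite -(Wq i ir) -E /winsor -/N -/lo -/hi phi_id // lexx andbT.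
  exact: lo_le_hi.
have yq i : ~~ bad i -> y i = q.
  rewrite /bad loq hiq !negb_or negbK -!leNgt => /and3P[/eqP <- h1 h2].
  by apply/eqP; rewrite eq_le h1 h2.
have [qmu|muq] := leP q mu; [left|right].
  apply: le_trans count_bad; rewrite ler_nat; apply: sub_count => i /=.
  by apply: contraTT => /yq ->; rewrite -leNgt.
apply: le_trans count_bad; rewrite ler_nat; apply: sub_count => i /=.
by apply: contraTT => /yq ->; rewrite -ltNge.
Qed.

End ContaminatedSample.

(** The right side exceeds the left by N (a - c) ^ 2, with a the average. It allows the winsorized
    variance to be centred at the true mean. *)
Lemma sum_sqr_mean (R : realFieldType) (I : Type) (r : seq I) (f : I -> R) (c : R) :
  (0 < size r)%N ->
  \sum_(i <- r) (f i - (size r)%:R^-1 * \sum_(l <- r) f l) ^+ 2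
    <= \sum_(i <- r) (f i - c) ^+ 2.
Proof.
move=> r0; set N : R := (size r)%:R; set a := N^-1 * _.
have N0 : 0 < N by rewrite ltr0n.
have Na : \sum_(i <- r) f i = N * a by rewrite /a mulrA divff ?mul1r ?gt_eqF.
have sq b : \sum_(i <- r) (f i - b) ^+ 2 =
    \sum_(i <- r) f i ^+ 2 - (2 * b) * (N * a) + N * b ^+ 2.
  have -> : N * b ^+ 2 = \sum_(i <- r) b ^+ 2 by rewrite sumr_count count_predT.
  rewrite -Na mulr_sumr -sumrB -big_split /=.
  by apply: eq_bigr => i _; ring.
rewrite !sq -subr_ge0.
have -> : forall u : R, u - 2 * c * (N * a) + N * c ^+ 2 -
    (u - 2 * a * (N * a) + N * a ^+ 2) = N * (a - c) ^+ 2 by move=> u; ring.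
by rewrite mulr_ge0 ?sqr_ge0 // ltW.
Qed.

(** * From winsorized sums to the studentized statistic *)

Section WinsorizedStat.
Context (R : realType).

(** The drift n mu survives in the winsorized sum up to the winsorization error and the fluctuation
    of the clean sum; division by sqrt n times the winsorized standard deviation follows. [K] bounds
    both the mean m-th moment and the normalized fluctuation. The pairs [e], [T] and [e'], [T']
    belong to numerator and normalization. *)
Lemma winsorized_stat_ge k n (x xt : nat -> k.-tuple R) (j : 'I_k)
    (t : k.-tuple R) (mu m e e' eta K T T' : R) :
    (0 < n)%N -> 0 < e < 1 / 2 -> 0 < e' < 1 / 2 -> eta <= e -> eta <= e' ->
    (count (fun i => xt i != x i) (index_iota 1 n.+1))%:R <= eta * n%:R ->
    2 < m -> 1 <= T -> 1 <= T' ->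
    K < T `^ m * (e - eta) -> K < T' `^ m * (e' - eta) ->
    \sum_(1 <= i < n.+1) `|tnth (x i) j - mu| `^ m <= K * n%:R ->
    `|\sum_(1 <= i < n.+1) (tnth (x i) j - mu)| <= K * Num.sqrt n%:R ->
    3 * e' * n%:R < (count (fun i => mu < tnth (x i) j) (index_iota 1 n.+1))%:R ->
    3 * e' * n%:R < (count (fun i => tnth (x i) j <= mu) (index_iota 1 n.+1))%:R ->
    winsorized_stat e e' n xt t ->
  Num.sqrt n%:R * `|mu| - K - Num.sqrt n%:R * (6 * e * T + K / T `^ (m - 1))
    <= `|tnth t j| * Num.sqrt (3 * e' * T' ^+ 2 + 1 + K).
Proof.
move=> n0 /andP[e0 e1] /andP[e'0 e'1] etae etae' cont m2 T1 T'1 KT KT'.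
set r := index_iota 1 n.+1; set y := fun i => tnth (x i) j.
set yt := fun i => tnth (xt i) j.
have szr : size r = n by rewrite size_iota subn1.
have szs : size (coords n xt j) = n by rewrite size_map.
have r0 : (0 < size r)%N by rewrite szr.
have cont' : (count (fun i => yt i != y i) r)%:R <= eta * (size [seq yt i | i <- r])%:R.
  rewrite size_map szr; apply: le_trans cont; rewrite ler_nat.
  apply: sub_count => i /=; apply: contra => /eqP xx.
  by rewrite /yt xx.
move=> mom dev cgt cle /(_ j) stat.
have mom' : \sum_(i <- r) `|y i - mu| `^ m <= K * (size [seq yt i | i <- r])%:R.
  by rewrite size_map szr.
have N0 : 0 < n%:R :> R by rewrite ltr0n.
(* At zero normalization [winsorized_stat] leaves [t] free. All winsorized values would then equal
   their mean, which the two counts exceeding 3 e' n exclude. *)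
have sd0 : wsd e' n xt j != 0.
  rewrite /wsd; apply/eqP => sd0.
  have cov_ge0 : 0 <= wcov e' n xt j j.
    rewrite mxE mulr_ge0 ?invr_ge0 ?ler0n // sumr_ge0 // => i _.
    by rewrite -expr2 sqr_ge0.
  have : wcov e' n xt j j = 0.
    by rewrite -(sqr_sqrtr cov_ge0) sd0 expr0n.
  rewrite mxE => /eqP; rewrite mulf_eq0 invr_eq0 (gt_eqF N0) /= => /eqP S0.
  have W0 : forall i, i \in r -> winsor e' (coords n xt j) (yt i) = wmean e' n xt j.
    move=> i ir; apply/eqP; rewrite -subr_eq0 -sqrf_eq0 expr2.
    move/eqP: S0; rewrite psumr_eq0 => [/allP /(_ _ ir) //|l _].
    by rewrite -expr2 sqr_ge0.
  have := winsorized_constant (y := y) (yt := yt) mu r0 e'0 e'1 etae' cont' W0.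
  by rewrite size_map szr => -[]; rewrite leNgt ?cgt ?cle.
have sd_gt0 : 0 < wsd e' n xt j by rewrite lt_neqAle eq_sym sd0 sqrtr_ge0.
have sd_le : wsd e' n xt j <= Num.sqrt (3 * e' * T' ^+ 2 + 1 + K).
  rewrite ler_wsqrtr // mxE mulrC ler_pdivrMr // mulrC.
  have := winsorized_sum_sqr (y := y) (yt := yt) r0 e'0 e'1 etae' cont' m2 T'1 KT' mom'.
  rewrite size_map szr; apply: le_trans.
  have := @sum_sqr_mean R _ r (fun i => winsor e' (coords n xt j) (yt i)) mu r0.
  apply: le_trans; rewrite szr le_eqVlt; apply/orP; left; apply/eqP.
  by apply: eq_bigr => i _; rewrite expr2.
have := winsorized_sum_dist (y := y) (yt := yt) r0 e0 e1 etae cont' m2 T1 KT mom'.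
rewrite size_map szr => dist.
set S := \sum_(i <- r) winsor e (coords n xt j) (yt i) in dist *.
have sn0 : 0 < Num.sqrt n%:R :> R by rewrite sqrtr_gt0.
have E : Num.sqrt n%:R * (`|tnth t j| * wsd e' n xt j) = `|S|.
  rewrite (stat sd0) -/S normrM normfV (gtr0_norm (mulr_gt0 sn0 sd_gt0)).
  by field; rewrite !gt_eqF.
apply: (@le_trans _ _ (`|tnth t j| * wsd e' n xt j)); last by rewrite ler_wpM2l.
rewrite -(ler_pM2l sn0) E.
have -> : forall u v : R, Num.sqrt n%:R * (Num.sqrt n%:R * u - K - Num.sqrt n%:R * v)
    = Num.sqrt n%:R ^+ 2 * u - K * Num.sqrt n%:R - Num.sqrt n%:R ^+ 2 * v.
  by move=> u v; ring.
rewrite sqr_sqrtr ?ler0n //.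
(* Splits n mu into the winsorized sum, its distance from the clean sum, and the clean
   fluctuation. *)
have nmu : n%:R * mu = \sum_(i <- r) y i - \sum_(i <- r) (y i - mu).
  have -> : n%:R * mu = \sum_(i <- r) mu by rewrite sumr_count count_predT szr.
  rewrite -sumrB; by apply: eq_bigr => i _; ring.
have : n%:R * `|mu| = `|S - (S - \sum_(i <- r) y i) - \sum_(i <- r) (y i - mu)|.
  have -> : S - (S - \sum_(i <- r) y i) - \sum_(i <- r) (y i - mu) = n%:R * mu.
    by rewrite nmu; ring.
  by rewrite normrM ger0_norm // ltW.
have := ler_normB (S - (S - \sum_(i <- r) y i)) (\sum_(i <- r) (y i - mu)).
have := ler_normB S (S - \sum_(i <- r) y i).
by rewrite -/y in dev; lra.
Qed.

End WinsorizedStat.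

(** * Expectations and concentration *)

Section Expectation.
Context d (T : measurableType d) (R : realType) (P : probability T R).
Implicit Types f g : T -> R.
Local Notation intg f := (P.-integrable [set: T] (EFin \o f)).

Lemma fine_expectation f : fine 'E_P[f]%E = \int[P]_w f w.
Proof. by rewrite unlock. Qed.

Lemma intg_measurable f : intg f -> measurable_fun [set: T] f.
Proof. by move=> /integrableP[/measurable_EFinP]. Qed.

Lemma intg_le f g : measurable_fun [set: T] f ->
  (forall w, `|f w| <= g w) -> intg g -> intg f.
Proof.
move=> mf fg ig; apply: (le_integrable measurableT _ _ ig).
  exact/measurable_EFinP.
by move=> w _ /=; rewrite lee_fin (le_trans (fg w)) // ler_norm.
Qed.

Lemma intg_cst (c : R) : intg (fun=> c).
Proof. exact: finite_measure_integrable_cst. Qed.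

Lemma intgD f g : intg f -> intg g -> intg (fun w => f w + g w).
Proof. by move=> hf hg; exact: (integrableD measurableT hf hg). Qed.

Lemma intgZ (c : R) f : intg f -> intg (fun w => c * f w).
Proof. by move=> hf; exact: (integrableZl measurableT c hf). Qed.

Lemma intg_sum (I : eqType) (r : seq I) (f : I -> T -> R) :
  (forall i, i \in r -> intg (f i)) -> intg (fun w => \sum_(i <- r) f i w).
Proof.
elim: r => [|i r ih] hf.
  by under [X in intg X]eq_fun do rewrite big_nil; exact: intg_cst.
under [X in intg X]eq_fun do rewrite big_cons.
apply: intgD; first by apply: hf; rewrite mem_head.
by apply: ih => l lr; apply: hf; rewrite inE lr orbT.
Qed.

Lemma Ex_sum (I : eqType) (r : seq I) (f : I -> T -> R) :
  (forall i, i \in r -> intg (f i)) ->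
  \int[P]_w (\sum_(i <- r) f i w) = \sum_(i <- r) \int[P]_w f i w.
Proof.
elim: r => [|i r ih] hf.
  by rewrite big_nil; under eq_Rintegral do rewrite big_nil; rewrite Rintegral_cst // mul0r.
have hr l : l \in r -> intg (f l) by move=> lr; apply: hf; rewrite inE lr orbT.
rewrite big_cons -ih // -RintegralD //; last exact: intg_sum.
  by apply: eq_Rintegral => w _; rewrite big_cons.
by apply: hf; rewrite mem_head.
Qed.

Lemma Ex_cst (c : R) : \int[P]_w c = c.
Proof. by rewrite Rintegral_cst //= probability_setT mulr1. Qed.

Lemma intgM f g : measurable_fun [set: T] f -> measurable_fun [set: T] g ->
  intg (fun w => f w ^+ 2) -> intg (fun w => g w ^+ 2) ->
  intg (fun w => f w * g w).
Proof.
move=> mf mg f2 g2; apply: intg_le (intgD f2 g2).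
  exact: measurable_funM.
move=> w /=; rewrite normrM -[f w ^+ 2]real_normK ?num_real //.
rewrite -[g w ^+ 2]real_normK ?num_real //.
have := sqr_ge0 (`|f w| - `|g w|); have := sqr_ge0 (`|f w| + `|g w|); nra.
Qed.

Lemma Ex_fin f : intg f -> (\int[P]_w f w)%:E = (\int[P]_w (f w)%:E)%E.
Proof. by move=> hf; rewrite fineK // integrable_fin_num. Qed.

Lemma markov_ge0 f c : intg f -> (forall w, 0 <= f w) -> 0 < c ->
  (P [set w | (c <= f w)%R] <= (c^-1 * \int[P]_w f w)%:E)%E.
Proof.
move=> hf f0 c0; have mf := intg_measurable hf.
pose X : {RV P >-> R} := mfun_Sub (mem_set mf).
have := @markov _ _ _ P X id c c0 (@measurable_id _ _ _) (fun _ h => h) (fun _ _ _ _ h => h).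
have -> : [set x | c%:E <= `|(X x)%:E| ]%E = [set w | (c <= f w)%R].
  by apply/seteqP; split => w /=; rewrite lee_fin /= ger0_norm.
rewrite EFinM Ex_fin // unlock /=.
rewrite (_ : (\int[P]_x `|f x|%:E = \int[P]_w (f w)%:E)%E); last first.
  by apply: eq_integral => w _; rewrite ger0_norm.
by rewrite lee_pdivlMl.
Qed.

(** In the expanded square the cross terms integrate to 0, leaving at most V times the sum of
    squared weights. The weights are 1 for the sample and a row of the square-root matrix for the
    Gaussian vector. *)
Lemma chebyshev_sum (I : eqType) (r : seq I) (a : I -> R) (Y : I -> T -> R)
    (V t : R) : uniq r -> (forall i, i \in r -> measurable_fun [set: T] (Y i)) ->
    (forall i, i \in r -> intg (fun w => Y i w ^+ 2)) ->
    (forall i, i \in r -> \int[P]_w (Y i w ^+ 2) <= V) ->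
    (forall i j, i \in r -> j \in r -> i != j -> \int[P]_w (Y i w * Y j w) = 0) ->
    0 < t ->
  (P [set w | (t <= `|\sum_(i <- r) a i * Y i w|)%R] <=
    (V * \sum_(i <- r) a i ^+ 2 / t ^+ 2)%:E)%E.
Proof.
move=> ur mY Y2 YV Yij t0.
have sqE w : (\sum_(i <- r) a i * Y i w) ^+ 2 =
    \sum_(i <- r) \sum_(j <- r) (a i * a j) * (Y i w * Y j w).
  rewrite expr2 mulr_suml; apply: eq_bigr => i _; rewrite mulr_sumr.
  by apply: eq_bigr => j _; ring.
have ij i j : i \in r -> j \in r -> intg (fun w => Y i w * Y j w).
  by move=> ir jr; apply: intgM; [exact: mY|exact: mY|exact: Y2|exact: Y2].
have iij i j : i \in r -> j \in r -> intg (fun w => (a i * a j) * (Y i w * Y j w)).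
  by move=> ir jr; apply: intgZ; exact: ij.
have iS : intg (fun w => (\sum_(i <- r) a i * Y i w) ^+ 2).
  under [X in intg X]eq_fun do rewrite sqE.
  by apply: intg_sum => i ir; apply: intg_sum => j; exact: iij.
have t20 : 0 < t ^+ 2 by rewrite exprn_gt0.
have := markov_ge0 iS (fun w => sqr_ge0 _) t20.
have -> : [set w | (t ^+ 2 <= (\sum_(i <- r) a i * Y i w) ^+ 2)%R] =
    [set w | (t <= `|\sum_(i <- r) a i * Y i w|)%R].
  apply/seteqP; split => w /=; set u := \sum_(i <- r) _;
    by rewrite -(real_normK (num_real u)) ler_sqr ?nnegrE // ltW.
move=> /le_trans; apply; rewrite lee_fin.
under eq_Rintegral do rewrite sqE.
rewrite Ex_sum; last by move=> i ir; apply: intg_sum => j; exact: iij.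
rewrite -mulr_suml mulrA mulrC ler_pM2r ?invr_gt0 //.
rewrite mulr_sumr big_seq [leRHS]big_seq; apply: ler_sum => i ir.
rewrite Ex_sum; last by move=> j; exact: iij.
rewrite (bigD1_seq i) //= big_seq_cond big1 ?addr0; last first.
  move=> j /andP[jr ji]; rewrite RintegralZl //; last exact: ij.
  by rewrite Yij ?mulr0 // eq_sym.
rewrite RintegralZl //; last exact: ij.
rewrite -expr2 mulrC ler_wpM2r ?sqr_ge0 //.
under eq_Rintegral do rewrite -expr2.
exact: YV.
Qed.

End Expectation.

(** * Expectation of a product of independent variables *)

Section Independence.
Context d (T : measurableType d) (R : realType) (P : probability T R).
Local Notation intg f := (P.-integrable [set: T] (EFin \o f)).

(** Factorization on rectangles identifies the joint law with the product of the marginals; Fubini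
    then splits the integral. *)
Lemma Ex_indep_mul (f g : T -> R) :
    measurable_fun [set: T] f -> measurable_fun [set: T] g ->
    (forall A B : set R, measurable A -> measurable B ->
      P (f @^-1` A `&` g @^-1` B) = (P (f @^-1` A) * P (g @^-1` B))%E) ->
    intg f -> intg g -> intg (fun w => f w * g w) ->
  \int[P]_w (f w * g w) = \int[P]_w f w * \int[P]_w g w.
Proof.
move=> mf mg indep hf hg hfg.
pose F : {mfun T >-> R} := mfun_Sub (mem_set mf).
pose G : {mfun T >-> R} := mfun_Sub (mem_set mg).
have mh : measurable_fun [set: T] (fun w => (f w, g w)).
  exact: measurable_fun_pair.
pose H : {mfun T >-> (R * R)%type} := mfun_Sub (mem_set mh).
pose k : R * R -> \bar R := fun z => (z.1 * z.2)%:E.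
have mk : measurable_fun [set: R * R] k.
  by apply/measurable_EFinP; apply: measurable_funM.
have joint A : measurable A ->
    (distribution P F \x distribution P G)%E A = distribution P H A.
  apply: product_measure_unique => A1 A2 mA1 mA2.
  by rewrite /= /distribution /pushforward /= -indep.
have iH : (distribution P H).-integrable [set: R * R] k.
  exact: (integrable_pushforward mh mk hfg).
have iFG : ((distribution P F \x distribution P G)%E).-integrable [set: R * R] k.
  apply/integrableP; split => //; move/integrableP : iH => [_].
  have abs : forall A, measurable A -> A `<=` [set: R * R] ->
      (distribution P F \x distribution P G)%E A = distribution P H A.
    by move=> A mA _; exact: joint.
  by rewrite (eq_measure_integral (distribution P H) abs).
have E1 : (\int[P]_w (f w * g w)%:E = \int[distribution P H]_z k z)%E.
  by rewrite (integral_pushforward mh mk hfg).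
have mE : measurable_fun [set: R] (@EFin R) by exact/measurable_EFinP.
have E2 : (\int[distribution P F]_x x%:E = \int[P]_w (f w)%:E)%E.
  by rewrite (integral_pushforward mf mE hf).
have E3 : (\int[distribution P G]_x x%:E = \int[P]_w (g w)%:E)%E.
  by rewrite (integral_pushforward mg mE hg).
have iF : (distribution P F).-integrable [set: R] (@EFin R).
  exact: (integrable_pushforward mf mE hf).
have iG : (distribution P G).-integrable [set: R] (@EFin R).
  exact: (integrable_pushforward mg mE hg).
rewrite {1}/Rintegral E1.
have abs : forall A, measurable A -> A `<=` [set: R * R] ->
    distribution P H A = (distribution P F \x distribution P G)%E A.
  by move=> A mA _; rewrite joint.
rewrite (eq_measure_integral _ abs).
rewrite -integral12_prod_meas1 //.
rewrite /fubini_F /k /=.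
under eq_integral => x _.
  under eq_integral do rewrite EFinM.
  rewrite integralZl // E3 -Ex_fin //.
  over.
by rewrite /= integralZr // E2 -Ex_fin // -EFinM.
Qed.

End Independence.

Section Linearity.
Context d (T : measurableType d) (R : realType) (P : probability T R).
Local Notation intg f := (P.-integrable [set: T] (EFin \o f)).

Lemma ExD (f g : T -> R) : intg f -> intg g ->
  \int[P]_w (f w + g w) = \int[P]_w f w + \int[P]_w g w.
Proof. exact: RintegralD. Qed.

Lemma ExZ (c : R) (f : T -> R) : intg f ->
  \int[P]_w (c * f w) = c * \int[P]_w f w.
Proof. exact: RintegralZl. Qed.

Lemma Ex_le (f g : T -> R) : intg f -> intg g -> (forall w, f w <= g w) ->
  \int[P]_w f w <= \int[P]_w g w.
Proof. by move=> hf hg fg; apply: le_Rintegral. Qed.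

Lemma intg_indic (A : set T) : measurable A -> intg (\1_A : T -> R).
Proof. by move=> mA; exact: integrable_indic. Qed.

Lemma Ex_indic (A : set T) : measurable A -> \int[P]_w (\1_A w : R) = fine (P A).
Proof. by move=> mA; rewrite /Rintegral integral_indic // setIT. Qed.

Lemma sqr_truncation (z t m : R) : 0 < t -> 2 < m ->
  z ^+ 2 <= t * `|z| + `|z| `^ m / t `^ (m - 2).
Proof.
move=> t0 m2; have tm := powR_gt0 (m - 2) t0.
have zm := powR_ge0 `|z| m; rewrite -real_normK ?num_real //.
have z0 := normr_ge0 z; case: (leP `|z| t) => [zt|/ltW tz].
  have : `|z| ^+ 2 <= t * `|z| by rewrite expr2 ler_wpM2r.
  have : 0 <= `|z| `^ m / t `^ (m - 2) by rewrite divr_ge0 // ltW.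
  lra.
suff : `|z| ^+ 2 <= `|z| `^ m / t `^ (m - 2).
  have : 0 <= t * `|z| by rewrite mulr_ge0 // ltW.
  lra.
rewrite ler_pdivlMr //.
have zn0 : 0 < `|z| by apply: lt_le_trans tz.
have -> : `|z| `^ m = `|z| ^+ 2 * `|z| `^ (m - 2).
  rewrite -powR_mulrn // -powRD; last by apply/implyP => _; rewrite gt_eqF.
  by congr powR; ring.
have m20 : 0 <= m - 2 by lra.
by rewrite ler_wpM2l ?sqr_ge0 // ge0_ler_powR ?nnegrE // ltW.
Qed.

End Linearity.

(** A bound of Paley-Zygmund type: a centred variable with little mass above 0 has a small absolute
    first moment, and the m-th moment bound then makes its variance small too. Applied to f and to
    -f, it bounds the mass on both sides of the mean. *)
Lemma mass_above_mean (R : realType) (m b B : R) : 2 < m -> 0 < b -> 0 <= B ->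
  exists2 p0 : R, 0 < p0 & forall d (T : measurableType d) (P : probability T R)
    (f : T -> R), P.-integrable [set: T] (EFin \o f) ->
    P.-integrable [set: T] (EFin \o (fun w => `|f w| `^ m)) ->
    \int[P]_w f w = 0 -> b <= \int[P]_w (f w ^+ 2) ->
    \int[P]_w (`|f w| `^ m) <= B ->
  p0 <= fine (P [set w | 0 < f w]).
Proof.
(* Chosen so that B / s <= b / 4; the summand 1 keeps [s] positive when B = 0. *)
move=> m2 b0 B0; pose s := 1 + 4 * B / b.
have s0 : 0 < s.
  have : 0 <= 4 * B / b by rewrite divr_ge0 ?mulr_ge0 // ltW.
  by rewrite /s; lra.
pose t := s `^ (m - 2)^-1; have t0 : 0 < t by exact: powR_gt0.
have ts : t `^ (m - 2) = s.
  by rewrite /t -powRrM mulVf ?powRr1 ?ltW // gt_eqF //; lra.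
have B1 : 0 < 1 + B by lra.
(* Chosen so that 2 t (1 + B) / u = b / 4, the second quarter of [b] to be absorbed. *)
have [u u0 uE] : exists2 u, 0 < u & u = 8 * t * (1 + B) / b.
  by exists (8 * t * (1 + B) / b) => //; rewrite divr_gt0 // !mulr_gt0.
exists (b / (8 * t * u)).
  by rewrite divr_gt0 // !mulr_gt0.
have u2 : 0 <= 2 / u by rewrite divr_ge0 // ltW.
move=> d T P f hf hm f0 fb fB; have mf := intg_measurable hf.
set A := [set w | 0 < f w].
have mA : measurable A.
  have -> : A = [set: T] `&` f @^-1` `]0, +oo[%classic.
    by rewrite setTI; apply/seteqP; split => w; rewrite /A /= in_itv /= andbT.
  exact: mf.
have iA := intg_indic P mA.
pose c1 := 2 * t * u; pose c2 := 2 * t / u + s^-1.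
pose g w := (c1 * \1_A w + c2 * `|f w| `^ m) + (2 * t / u + - t * f w).
(* [f ^ 2 <= t |f| + |f| ^ m / t ^ (m - 2)], where [|f| = 2 f^+ - f] and
   [f^+ <= u 1_A + f ^ 2 / u]; integrating gives [b <= 2 t u P(A) + b / 2]. *)
have fg w : f w ^+ 2 <= g w.
  apply: (le_trans (sqr_truncation (f w) t0 m2)); rewrite ts.
  have f2 := sqr_le_powR (f w) (ltW m2).
  suff : `|f w| <= 2 * u * \1_A w + 2 / u * (1 + `|f w| `^ m) - f w.
    rewrite -(ler_pM2l t0) => h; rewrite /g /c1 /c2.
    have -> : forall a x y : R, 2 * t * u * a + (2 * t / u + s^-1) * x +
      (2 * t / u + - t * y) =
      t * (2 * u * a + 2 / u * (1 + x) - y) + x / s by move=> *; ring.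
    by rewrite lerD2r.
  have h1 : 0 <= 2 / u * (1 + `|f w| `^ m).
    by rewrite mulr_ge0 // addr_ge0 // powR_ge0.
  set x := `|f w| `^ m in f2 h1 *.
  case: (leP (f w) 0) => [fle|fgt].
    rewrite ler0_norm // indicE memNset; last by rewrite /A /= ltNge fle.
    by rewrite mulr0; lra.
  rewrite gtr0_norm // indicE mem_set //= mulr1.
  have h2 : 2 * f w <= 2 * u + 2 / u * f w ^+ 2.
    rewrite -(ler_pM2l u0) mulrDr.
    have -> : u * (2 / u * f w ^+ 2) = 2 * f w ^+ 2 by field; lra.
    by have := sqr_ge0 (f w - u); have := sqr_ge0 (f w); have := sqr_ge0 u; nra.
  have h3 : 2 / u * f w ^+ 2 <= 2 / u * (1 + x).
    by rewrite ler_wpM2l.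
  lra.
have ig1 : P.-integrable [set: T] (EFin \o (fun w => c1 * \1_A w + c2 * `|f w| `^ m)).
  by apply: intgD; apply: intgZ.
have ig2 : P.-integrable [set: T] (EFin \o (fun w => 2 * t / u + - t * f w)).
  by apply: intgD; [exact: intg_cst|exact: intgZ].
have ig : P.-integrable [set: T] (EFin \o g) by exact: intgD.
have if2 : P.-integrable [set: T] (EFin \o (fun w => f w ^+ 2)).
  apply: intg_le ig; first exact: measurable_funX.
  by move=> w; rewrite ger0_norm ?sqr_ge0.
have := Ex_le if2 ig fg.
rewrite /g ExD // ExD; [|exact: intgZ|exact: intgZ].
rewrite ExD; [|exact: intg_cst|exact: intgZ].
rewrite Ex_cst !ExZ // Ex_indic // f0 mulr0 addr0 => h.
set p := fine (P A) in h *.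
have c20 : 0 <= c2.
  by rewrite /c2 addr_ge0 ?invr_ge0 ?divr_ge0 ?mulr_ge0 // ltW.
have h2 : b <= c1 * p + (c2 * B + 2 * t / u).
  apply: le_trans fb _; apply: le_trans h _.
  by rewrite -addrA lerD2l lerD2r ler_wpM2l.
have E1 : 2 * t / u * (1 + B) = b / 4 by rewrite uE; field; rewrite !gt_eqF.
have E2 : B / s <= b / 4.
  rewrite ler_pdivrMr // /s.
  have -> : b / 4 * (1 + 4 * B / b) = b / 4 + B by field; lra.
  lra.
rewrite ler_pdivrMr; last by rewrite !mulr_gt0.
have : c2 * B + 2 * t / u = 2 * t / u * (1 + B) + B / s by rewrite /c2; ring.
rewrite /c1 in h2; nra.
Qed.

(** * Integrals of identically distributed variables *)

Section IdenticallyDistributed.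
Context d (T : measurableType d) (R : realType) (P : probability T R).
Local Notation intg f := (P.-integrable [set: T] (EFin \o f)).

Section Transfer.
Context (f g : T -> R) (h : R -> R).
Context (mf : measurable_fun [set: T] f) (mg : measurable_fun [set: T] g).
Context (mh : measurable_fun [set: R] h).
Context (fg : forall A : set R, measurable A -> P (f @^-1` A) = P (g @^-1` A)).

Let F : {mfun T >-> R} := mfun_Sub (mem_set mf).
Let G : {mfun T >-> R} := mfun_Sub (mem_set mg).

Let mE : measurable_fun [set: R] (EFin \o h).
Proof. exact/measurable_EFinP. Qed.

Let FG A : measurable A -> A `<=` [set: R] -> distribution P F A = distribution P G A.
Proof. by move=> mA _; exact: fg. Qed.

(** The integrals of h along f and along g are integrals of h against the same pushforward law. [h]
    will be a shift, a square, a power or an indicator. *)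
Lemma ident_intg : intg (h \o g) -> intg (h \o f).
Proof.
move=> hg; apply/integrableP; split.
  by apply/measurable_EFinP; exact: measurableT_comp.
have mnE : measurable_fun [set: R] (fun x => `|(h x)%:E|%E).
  exact: measurableT_comp.
move/integrableP : hg => [_].
have E1 := @ge0_integral_pushforward _ _ _ _ R F mf P setT
  (fun x => `|(h x)%:E|%E) measurableT mnE (fun _ _ => abse_ge0 _).
have E2 := @ge0_integral_pushforward _ _ _ _ R G mg P setT
  (fun x => `|(h x)%:E|%E) measurableT mnE (fun _ _ => abse_ge0 _).
rewrite !preimage_setT in E1 E2.
by rewrite -[X in (X < _)%E -> _]E2 -[X in _ -> (X < _)%E]E1 (eq_measure_integral _ FG).
Qed.

Lemma ident_Ex : intg (h \o g) -> \int[P]_w h (f w) = \int[P]_w h (g w).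
Proof.
move=> hg; have hf := ident_intg hg; rewrite /Rintegral.
have E1 := integral_pushforward mf mE hf measurableT.
have E2 := integral_pushforward mg mE hg measurableT.
rewrite !preimage_setT in E1 E2.
by rewrite -[X in fine X = _]E1 -[X in _ = fine X]E2 (eq_measure_integral _ FG).
Qed.

End Transfer.
End IdenticallyDistributed.

Section Moments.
Context d (T : measurableType d) (R : realType) (P : probability T R).
Local Notation intg f := (P.-integrable [set: T] (EFin \o f)).

Lemma measurable_norm_powR (f : T -> R) m : measurable_fun [set: T] f ->
  measurable_fun [set: T] (fun w => `|f w| `^ m).
Proof.
move=> mf; apply: (measurableT_comp (measurable_powR m)).
exact: measurableT_comp.
Qed.

Lemma intg_powR_intg (f : T -> R) m : 1 <= m -> measurable_fun [set: T] f ->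
  intg (fun w => `|f w| `^ m) -> intg f.
Proof.
move=> m1 mf fm; apply: intg_le (intgD (intg_cst P 1) fm) => // w.
by have := norm_le_powR (f w) ltr01 m1; rewrite powR1 divr1.
Qed.

Lemma intg_powR_sqr (f : T -> R) m : 2 <= m -> measurable_fun [set: T] f ->
  intg (fun w => `|f w| `^ m) -> intg (fun w => f w ^+ 2).
Proof.
move=> m1 mf fm; apply: intg_le (intgD (intg_cst P 1) fm).
  exact: measurable_funX.
by move=> w; rewrite ger0_norm ?sqr_ge0 //; exact: sqr_le_powR.
Qed.

Lemma intg_powR_shift (f : T -> R) c m : 0 <= m -> measurable_fun [set: T] f ->
  intg (fun w => `|f w| `^ m) -> intg (fun w => `|f w - c| `^ m).
Proof.
move=> m0 mf fm.
apply: intg_le (intgZ (2 `^ m) (intgD fm (intg_cst P (`|c| `^ m)))).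
  by apply: measurable_norm_powR; exact: measurable_funB.
move=> w /=; rewrite ger0_norm ?powR_ge0 //.
apply: (@le_trans _ _ ((2 * Num.max `|f w| `|c|) `^ m)).
  rewrite ge0_ler_powR ?nnegrE ?mulr_ge0 ?le_max ?normr_ge0 //.
  apply: le_trans (ler_normB _ _) _; rewrite mulr_natl mulr2n.
  by rewrite lerD // le_max lexx ?orbT.
rewrite powRM ?le_max ?normr_ge0 // ler_wpM2l ?powR_ge0 //.
by case: (leP `|f w| `|c|) => _; rewrite ?lerDl ?lerDr powR_ge0.
Qed.

Lemma Ex_sqr_le_powR (f : T -> R) (m : R) : 2 <= m -> measurable_fun [set: T] f ->
  intg (fun w => `|f w| `^ m) ->
  \int[P]_w (f w ^+ 2) <= 1 + \int[P]_w (`|f w| `^ m).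
Proof.
move=> m2 mf fm; rewrite -[X in X + _](Ex_cst P) -ExD //; last exact: intg_cst.
apply: Ex_le => [||w]; last exact: sqr_le_powR.
  exact: intg_powR_sqr fm.
by apply: intgD => //; exact: intg_cst.
Qed.

Lemma measurable_ge (f : T -> R) c : measurable_fun [set: T] f ->
  measurable [set w | c <= f w].
Proof.
move=> mf; have -> : [set w | c <= f w] = [set: T] `&` f @^-1` `[c, +oo[%classic.
  by rewrite setTI; apply/seteqP; split => w; rewrite /= in_itv /= andbT.
exact: mf.
Qed.

Lemma measurable_gt (f : T -> R) c : measurable_fun [set: T] f ->
  measurable [set w | c < f w].
Proof.
move=> mf; have -> : [set w | c < f w] = [set: T] `&` f @^-1` `]c, +oo[%classic.
  by rewrite setTI; apply/seteqP; split => w; rewrite /= in_itv /= andbT.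
exact: mf.
Qed.

End Moments.

(** Three exceptional events: Markov for the empirical moment gives B / K, Chebyshev for the centred
    sum gives (1 + B) / K ^ 2, and Chebyshev for the number of observations above [mu] gives 4 / (n
    p0 ^ 2). Pairwise independence suffices for these second-moment bounds. *)
Lemma iid_concentration (R : realType) (m b B : R) :
    2 < m -> 0 < b -> 0 <= B ->
  exists2 p0 : R, 0 < p0 & forall d (T : measurableType d) (P : probability T R)
      (n : nat) (Y : nat -> T -> R),
    (0 < n)%N -> (forall i, measurable_fun [set: T] (Y i)) ->
    (forall i l, (1 <= i <= n)%N -> (1 <= l <= n)%N -> i != l ->
      forall A C : set R, measurable A -> measurable C ->
      P (Y i @^-1` A `&` Y l @^-1` C) = (P (Y i @^-1` A) * P (Y l @^-1` C))%E) ->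
    (forall i, (1 <= i <= n)%N -> forall A : set R, measurable A ->
      P (Y i @^-1` A) = P (Y 1%N @^-1` A)) ->
    P.-integrable [set: T] (EFin \o (fun w => `|Y 1%N w| `^ m)) ->
    let mu := \int[P]_w Y 1%N w in
    b <= \int[P]_w ((Y 1%N w - mu) ^+ 2) ->
    \int[P]_w (`|Y 1%N w - mu| `^ m) <= B ->
    forall K : R, 0 < K ->
  exists E : set T, [/\ measurable E,
    (P E <= (B / K + (1 + B) / K ^+ 2 + 4 / (n%:R * p0 ^+ 2))%:E)%E &
    forall w, ~ E w ->
    [/\ \sum_(1 <= i < n.+1) `|Y i w - mu| `^ m <= K * n%:R,
     `|\sum_(1 <= i < n.+1) (Y i w - mu)| <= K * Num.sqrt n%:R,
     p0 / 2 * n%:R <= (count (fun i => (mu < Y i w)%R) (index_iota 1 n.+1))%:R &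
     p0 / 2 * n%:R <= (count (fun i => (Y i w <= mu)%R) (index_iota 1 n.+1))%:R]].
Proof.
move=> m2 b0 B0; have [p0 p0_gt0 mass] := mass_above_mean m2 b0 B0.
exists p0 => // d T P n Y n0 mY indep ident Ym mu Db DB K K0.
have m_ge1 : 1 <= m by lra.
have m_ge2 : 2 <= m by lra.
have m_ge0 : 0 <= m by lra.
have N0 : 0 < n%:R :> R by rewrite ltr0n.
have mD i : measurable_fun [set: T] (fun w => Y i w - mu).
  exact: measurable_funB.
have Dm1 : P.-integrable [set: T] (EFin \o (fun w => `|Y 1%N w - mu| `^ m)).
  exact: intg_powR_shift.
have DI1 : P.-integrable [set: T] (EFin \o (fun w => Y 1%N w - mu)).
  exact: intg_powR_intg m_ge1 (mD _) Dm1.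
have D21 : P.-integrable [set: T] (EFin \o (fun w => (Y 1%N w - mu) ^+ 2)).
  exact: intg_powR_sqr m_ge2 (mD _) Dm1.
have YI : P.-integrable [set: T] (EFin \o Y 1%N) by exact: intg_powR_intg m_ge1 (mY _) Ym.
have D01 : \int[P]_w (Y 1%N w - mu) = 0.
  by rewrite RintegralB //; [rewrite Ex_cst subrr|exact: intg_cst].
have mh1 : measurable_fun [set: R] (fun x : R => x - mu) by exact: measurable_funB.
have mh2 : measurable_fun [set: R] (fun x : R => (x - mu) ^+ 2).
  exact: measurable_funX.
have mhm : measurable_fun [set: R] (fun x : R => `|x - mu| `^ m).
  exact: measurable_norm_powR.
set r := index_iota 1 n.+1.
have rP i : i \in r -> (1 <= i <= n)%N by rewrite mem_index_iota.
have ur : uniq r by exact: iota_uniq.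
have szr : size r = n by rewrite size_iota subn1.
have Dm i : i \in r -> P.-integrable [set: T] (EFin \o (fun w => `|Y i w - mu| `^ m)).
  by move=> /rP ir; exact: (ident_intg (mY i) (mY 1%N) mhm (ident i ir)).
have DI i : i \in r -> P.-integrable [set: T] (EFin \o (fun w => Y i w - mu)).
  by move=> /rP ir; exact: (ident_intg (mY i) (mY 1%N) mh1 (ident i ir)).
have D2 i : i \in r -> P.-integrable [set: T] (EFin \o (fun w => (Y i w - mu) ^+ 2)).
  by move=> /rP ir; exact: (ident_intg (mY i) (mY 1%N) mh2 (ident i ir)).
have indep_comp (h : R -> R) i l : i \in r -> l \in r -> i != l ->
    measurable_fun [set: R] h ->
    forall A C : set R, measurable A -> measurable C ->
    P ((h \o Y i) @^-1` A `&` (h \o Y l) @^-1` C) =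
    (P ((h \o Y i) @^-1` A) * P ((h \o Y l) @^-1` C))%E.
  move=> /rP ir /rP lr il mh A C mA mC.
  have mp D : measurable D -> measurable (h @^-1` D).
    by move=> mD'; rewrite -[X in measurable X]setTI; exact: mh.
  exact: (indep _ _ ir lr il _ _ (mp _ mA) (mp _ mC)).
pose S w := \sum_(i <- r) `|Y i w - mu| `^ m.
have mS : P.-integrable [set: T] (EFin \o S) by exact: intg_sum.
(* The weight 1 gives the sum the shape of [chebyshev_sum]; likewise in [W] below. *)
pose U w := \sum_(i <- r) 1 * (Y i w - mu).
pose A := [set w | mu < Y 1%N w].
pose q := fine (P A).
pose ind (x : R) : R := (mu < x)%R%:R.
have mind : measurable_fun [set: R] ind.
  have -> : ind = \1_`]mu, +oo[%classic.
    apply/funext => x; rewrite /ind indicE; congr (_%:R).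
    by rewrite mem_setE in_itv /= andbT.
  exact: measurable_indic.
have iind (f : T -> R) c : measurable_fun [set: T] f ->
    P.-integrable [set: T] (EFin \o (fun w => (ind (f w) - c) ^+ 2)).
  move=> mf; apply: intg_le (intg_cst P ((1 + `|c|) ^+ 2)).
    by apply: measurable_funX; apply: measurable_funB => //; exact: measurableT_comp.
  move=> w; rewrite ger0_norm ?sqr_ge0 // -real_normK ?num_real //.
  rewrite ler_sqr ?nnegrE ?addr_ge0 //; apply: le_trans (ler_normB _ _) _.
  by rewrite lerD2r /ind; case: (_ < _); rewrite ?normr0 ?normr1.
have mA : measurable A by exact: measurable_gt.
have indA : (fun w => ind (Y 1%N w)) = \1_A.
  by apply/funext => w; rewrite /ind indicE; congr (_%:R); rewrite mem_setE.
have iindI f : measurable_fun [set: T] f -> P.-integrable [set: T] (EFin \o (ind \o f)).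
  move=> mf; apply: intg_le (intg_cst P 1); first exact: measurableT_comp.
  by move=> w /=; rewrite /ind; case: (_ < _); rewrite ?normr0 ?normr1.
have Eind i : i \in r -> \int[P]_w (ind (Y i w) - q) = 0.
  move=> /rP ir; rewrite RintegralB //; [|exact: iindI|exact: intg_cst].
  rewrite Ex_cst (ident_Ex (mY i) (mY 1%N) mind (ident i ir)) ?iindI //.
  by rewrite indA Ex_indic // subrr.
have PA : P A = q%:E by rewrite fineK // fin_num_measure.
have q01 : 0 <= q <= 1.
  by rewrite -!lee_fin -PA measure_ge0 probability_le1.
have q_ge : p0 <= q.
  rewrite /q /A; have -> : [set w | mu < Y 1%N w] = [set w | 0 < Y 1%N w - mu].
    by apply/seteqP; split => w /=; rewrite subr_gt0.
  exact: mass.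
(* The same mass bound for the reflected variable: the event Y 1 < mu lies in the complement of
   [A]. *)
have q_le : p0 <= 1 - q.
  have -> : 1 - q = fine (P (~` A)) by rewrite probability_setC // PA.
  have mfun : measurable_fun [set: T] (fun w => - (Y 1%N w - mu)).
    exact: measurable_funN.
  apply: (@le_trans _ _ (fine (P [set w | 0 < - (Y 1%N w - mu)]))).
    apply: mass.
    - by under eq_fun do rewrite -mulN1r; exact: intgZ.
    - by under eq_fun do rewrite normrN.
    - under eq_Rintegral do rewrite -mulN1r.
      by rewrite ExZ // D01 mulr0.
    - by under eq_Rintegral do rewrite sqrrN.
    - by under eq_Rintegral do rewrite normrN.
  rewrite fine_le ?fin_num_measure //; [exact: measurable_gt|exact: measurableC|].
  apply: le_measure; rewrite ?inE; [exact: measurable_gt|exact: measurableC|].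
  by move=> w /=; rewrite /A /= => h1 h2; lra.
pose W w := \sum_(i <- r) 1 * (ind (Y i w) - q).
have sn0 : 0 < Num.sqrt n%:R :> R by rewrite sqrtr_gt0.
have np0 : 0 < n%:R * p0 / 2 by rewrite divr_gt0 // mulr_gt0.
have mU : measurable_fun [set: T] U.
  by apply: measurable_sum => i; exact: measurable_funM.
have mW : measurable_fun [set: T] W.
  apply: measurable_sum => i; apply: measurable_funM => //.
  by apply: measurable_funB => //; exact: measurableT_comp.
pose E1 := [set w | K * n%:R <= S w].
pose E2 := [set w | K * Num.sqrt n%:R <= `|U w|].
pose E3 := [set w | n%:R * p0 / 2 <= `|W w|].
have mE1 : measurable E1 by exact: measurable_ge (intg_measurable mS).
have mE2 : measurable E2 by apply: measurable_ge; exact: measurableT_comp.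
have mE3 : measurable E3 by apply: measurable_ge; exact: measurableT_comp.
have PE1 : (P E1 <= (B / K)%:E)%E.
  apply: le_trans (markov_ge0 mS _ (mulr_gt0 K0 N0)) _.
    by move=> w; apply: sumr_ge0 => i _; exact: powR_ge0.
  rewrite lee_fin Ex_sum //.
  have -> : \sum_(i <- r) \int[P]_w (`|Y i w - mu| `^ m) =
      \sum_(i <- r) \int[P]_w (`|Y 1%N w - mu| `^ m).
    apply: eq_big_seq => i /rP ir.
    exact: (ident_Ex (mY i) (mY 1%N) mhm (ident i ir)).
  rewrite (sumr_count r predT) count_predT szr.
  set D := \int[P]_w _ in DB *.
  have -> : (K * n%:R)^-1 * (n%:R * D) = D / K by field; rewrite !gt_eqF.
  by rewrite ler_pM2r ?invr_gt0.
have PE2 : (P E2 <= ((1 + B) / K ^+ 2)%:E)%E.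
  apply: le_trans (@chebyshev_sum _ _ _ P _ r (fun=> 1) (fun i w => Y i w - mu) (1 + B)
    (K * Num.sqrt n%:R) ur _ D2 _ _ _) _ => //.
  - move=> i ir; apply: (@le_trans _ _ (\int[P]_w ((Y 1%N w - mu) ^+ 2))).
      by rewrite (ident_Ex (mY i) (mY 1%N) mh2 (ident i (rP _ ir))).
    apply: (@le_trans _ _ (1 + \int[P]_w (`|Y 1%N w - mu| `^ m))).
      exact: Ex_sqr_le_powR.
    by rewrite lerD2l.
  - move=> i l ir lr il; rewrite Ex_indep_mul //; last 4 first.
    + exact: (indep_comp (fun x => x - mu)).
    + exact: DI.
    + exact: DI.
    + by apply: intgM => //; exact: D2.
    by rewrite (ident_Ex (mY i) (mY 1%N) mh1 (ident i (rP _ ir))) // D01 mul0r.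
  - by rewrite mulr_gt0.
  rewrite lee_fin (sumr_count r predT) count_predT szr /= expr1n.
  rewrite exprMn sqr_sqrtr ?ler0n //.
  by rewrite le_eqVlt; apply/orP; left; apply/eqP; field; rewrite !gt_eqF.
(* A centred indicator has second moment at most 1, so deviation n p0 / 2 gives n / (n p0 / 2) ^ 2 =
   4 / (n p0 ^ 2). As [q] and 1 - q are at least [p0], a smaller deviation leaves n p0 / 2
   observations on each side. *)
have PE3 : (P E3 <= (4 / (n%:R * p0 ^+ 2))%:E)%E.
  apply: le_trans (@chebyshev_sum _ _ _ P _ r (fun=> 1) (fun i w => ind (Y i w) - q) 1
    (n%:R * p0 / 2) ur _ _ _ _ _) _ => //.
  - by move=> i _; apply: measurable_funB => //; exact: measurableT_comp.
  - by move=> i _; exact: iind.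
  - move=> i _; rewrite -[leRHS](Ex_cst P); apply: Ex_le => [||w].
    + exact: iind.
    + exact: intg_cst.
    + move/andP: q01 => [q0 q1]; rewrite /ind.
      have q2 : q ^+ 2 <= 1 by rewrite expr_le1.
      have p2 : (1 - q) ^+ 2 <= 1 by rewrite expr_le1 ?subr_ge0 // gerBl.
      by case: (_ < _) => //=; rewrite sub0r sqrrN.
  - move=> i l ir lr il; rewrite Ex_indep_mul //; last 6 first.
    + by apply: measurable_funB => //; exact: measurableT_comp.
    + by apply: measurable_funB => //; exact: measurableT_comp.
    + apply: (indep_comp (fun x => ind x - q)) => //.
      exact: measurable_funB.
    + by apply: intgD; [exact: iindI|exact: intg_cst].
    + by apply: intgD; [exact: iindI|exact: intg_cst].
    + apply: intgM => //; try exact: iind.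
        by apply: measurable_funB => //; exact: measurableT_comp.
      by apply: measurable_funB => //; exact: measurableT_comp.
    by rewrite Eind // mul0r.
  rewrite lee_fin (sumr_count r predT) count_predT szr /= expr1n mul1r.
  by rewrite le_eqVlt; apply/orP; left; apply/eqP; field; rewrite !gt_eqF.
exists (E1 `|` E2 `|` E3); split.
- by do 2 apply: measurableU => //.
- rewrite !EFinD; apply: le_trans (measureU2 _ _ _) _ => //.
    exact: measurableU.
  by rewrite leeD // (le_trans (measureU2 _ _ _)) // leeD.
move=> w /not_orP[/not_orP[nE1 nE2] nE3].
have {}nE1 : S w < K * n%:R by rewrite ltNge; apply/negP.
have {}nE2 : `|U w| < K * Num.sqrt n%:R by rewrite ltNge; apply/negP.
have {}nE3 : `|W w| < n%:R * p0 / 2 by rewrite ltNge; apply/negP.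
have UE : U w = \sum_(i <- r) (Y i w - mu).
  by apply: eq_bigr => i _; rewrite mul1r.
have WE : W w = (count (fun i => (mu < Y i w)%R) r)%:R - n%:R * q.
  rewrite /W; under eq_bigr do rewrite mul1r.
  rewrite sumrB (sumr_count r predT) count_predT szr; congr (_ - _).
  rewrite -[RHS]mulr1 -sumr_count [RHS]big_mkcond /=; apply: eq_bigr => i _.
  by rewrite /ind; case: (_ < _).
have cC : (count (fun i => (Y i w <= mu)%R) r)%:R =
    n%:R - (count (fun i => (mu < Y i w)%R) r)%:R :> R.
  rewrite -szr -(count_predC (fun i => (mu < Y i w)%R)) natrD addrC addKr.
  by congr (_%:R); apply: eq_count => i /=; rewrite -leNgt.
rewrite UE in nE2; rewrite WE ltr_norml in nE3; move/andP: nE3 => [nE3 nE4].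
have h1 : n%:R * p0 <= n%:R * q by rewrite ler_pM2l.
have h2 : n%:R * p0 <= n%:R * (1 - q) by rewrite ler_pM2l.
split; [exact: ltW|exact: ltW| |]; rewrite ?cC; last first.
  by move: nE4 h2; clear; lra.
by move: nE3 h1; clear; lra.
Qed.

(** * Moments of the standard normal law *)

Section NormalMoments.
Context (R : realType).
Local Notation leb := (@lebesgue_measure R).
Local Notation N01 := (@normal_prob R 0 1).
Local Notation pdf := (@normal_pdf R 0 1).
Import HBNNSimple.

(** For indicators this is the definition of [normal_prob]; simple functions follow by linearity,
    and nonnegative functions by monotone convergence on both sides. *)
Lemma integral_std_normal (f : _ -> \bar R) : (forall x, 0 <= f x)%E ->
  measurable_fun setT f ->
  (\int[N01]_x f x = \int[leb]_x (f x * (pdf x)%:E))%E.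
Proof.
move=> f0 mf; apply/esym; pose g (x : measurableTypeR R) := (pdf x)%:E.
have mg : measurable_fun setT g.
  by apply/measurable_EFinP; exact: measurable_normal_pdf.
have g0 x : (0 <= g x)%E by rewrite lee_fin normal_pdf_ge0.
pose h := nnsfun_approx measurableT mf.
have -> : (\int[N01]_x f x = lim (\int[N01]_x (EFin \o h n) x @[n --> \oo]))%E.
  have fE x : f x = lim ((EFin \o h n) x @[n --> \oo]).
    by apply/esym/cvg_lim => //; exact: cvg_nnsfun_approx.
  under eq_integral => x _ do rewrite fE.
  apply: monotone_convergence => //.
  - by move=> n; apply/measurable_EFinP; exact: (measurable_funP (h n)).
  - by move=> n x _ //=; rewrite lee_fin.
  - by move=> x _ a b ab; rewrite lee_fin; exact: (lefP _ _ (nd_nnsfun_approx measurableT mf ab) x).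
have -> : (\int[leb]_x (f x * g x) =
    lim (\int[leb]_x ((EFin \o h n) x * g x) @[n --> \oo]))%E.
  have fg x : (f x * g x = lim (((EFin \o h n) \* g) x @[n --> \oo]))%E.
    by apply/esym/cvg_lim => //; apply: cvgeZr => //; exact: cvg_nnsfun_approx.
  under eq_integral => x _ do rewrite fg.
  apply: monotone_convergence => [//| | |].
  - move=> n; apply: emeasurable_funM => //; apply/measurable_EFinP.
    exact: (measurable_funP (h n)).
  - by move=> n x _; apply: mule_ge0 => //; rewrite lee_fin; exact: (@fun_ge0 _ _ (h n) x).
  - move=> x _ a b ab; apply: lee_wpmul2r => //; rewrite lee_fin.
    exact: (lefP _ _ (nd_nnsfun_approx measurableT mf ab) x).
suff suf n : (\int[leb]_x ((EFin \o h n) x * g x) = \int[N01]_x (EFin \o h n) x)%E.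
  by under eq_fun do rewrite suf.
transitivity (\int[N01]_x
   (\sum_(y \in range (h n)) (y * \1_(h n @^-1` [set y]) x)%:E))%E; last first.
  by apply: eq_integral => t tE; rewrite /= fimfunE -fsumEFin.
have indich r : measurable_fun setT (fun x => (r * \1_(h n @^-1` [set r]) x)%:E).
  by apply/measurable_EFinP; exact: measurable_funM.
rewrite ge0_integral_fsum//; last by move=> m y Ey; exact: nnfun_muleindic_ge0.
transitivity (\int[leb]_x (\sum_(y \in range (h n))
    (y * \1_(h n @^-1` [set y]) x)%:E * g x))%E.
  under [RHS]eq_integral => x xE.
    rewrite -ge0_mule_fsuml => [|y]; last exact: nnfun_muleindic_ge0.
    rewrite fsumEFin // -(fimfunE _ x); over.
  by [].
rewrite ge0_integral_fsum//; last 2 first.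
  - by move=> y; apply: emeasurable_funM.
  - by move=> m y Ey; rewrite mule_ge0 // nnfun_muleindic_ge0.
apply: eq_fsbigr => r rhn.
under [RHS]eq_integral do rewrite EFinM.
rewrite integralZl_indic_nnsfun => //.
under eq_integral do rewrite EFinM -muleA.
rewrite ge0_integralZl//.
- under eq_integral do rewrite muleC.
  rewrite (eq_integral (g \_ (h n @^-1` [set r]))); last first.
    by move=> x xE; rewrite epatch_indic.
  rewrite -integral_mkcondr setTI integral_indic //; congr (_ * _)%E.
  by rewrite setIT.
- by apply: emeasurable_funM => //; exact/measurable_EFinP.
- by move=> t Et; apply: mule_ge0; [rewrite lee_fin|exact: g0].
- by move: rhn; rewrite inE => -[t _ <-]; rewrite lee_fin.
Qed.

(** The density is even and Lebesgue measure is invariant under reflection. This symmetry will give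
    the zero mean. *)
Lemma std_normal_prob_opp (A : set (measurableTypeR R)) : measurable A ->
  N01 (-%R @^-1` A) = N01 A.
Proof.
move=> mA; rewrite /normal_prob.
have mp : measurable_fun setT (fun x : measurableTypeR R => (pdf x)%:E).
  by apply/measurable_EFinP; exact: measurable_normal_pdf.
transitivity (\int[pushforward leb (-%R : _ -> measurableTypeR R)]_(x in A) (pdf x)%:E)%E.
  rewrite ge0_integral_pushforward //.
  - apply: eq_integral => x _ /=; congr (_%:E).
    by rewrite !normal_pdfE // /normal_fun !subr0 sqrrN.
  - exact: measurable_funTS.
  - by move=> x _; rewrite lee_fin normal_pdf_ge0.
by apply: eq_measure_integral => //= B mB _; exact: lebesgue_measureN.
Qed.

(* [x ^ 2 exp (- x ^ 2 / 2) <= 4 exp (- x ^ 2 / 4)], the density of N(0, 2) up to a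
   constant. *)
Lemma std_normal_second_moment :
  (\int[N01]_x ((x ^+ 2)%:E) < +oo)%E.
Proof.
have mx2 : measurable_fun [set: R] (fun x : R => (x ^+ 2)%:E).
  by apply/measurable_EFinP; exact: measurable_funX.
rewrite integral_std_normal //; last by move=> x; rewrite lee_fin sqr_ge0.
pose s := Num.sqrt 2 : R.
have s2 : s ^+ 2 = 2 by rewrite sqr_sqrtr.
have s0 : s != 0 by rewrite gt_eqF // sqrtr_gt0.
pose C := 4 * normal_peak (1 : R) / normal_peak s.
have C0 : 0 <= C by rewrite divr_ge0 ?mulr_ge0 ?normal_peak_ge0.
have mps : measurable_fun [set: R] (fun x => (normal_pdf 0 s x)%:E).
  by apply/measurable_EFinP; exact: measurable_normal_pdf.
apply: (@le_lt_trans _ _ (\int[leb]_x (C%:E * (normal_pdf 0 s x)%:E))%E); last first.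
  rewrite ge0_integralZl // ?integral_normal_pdf ?mule1 ?ltry //.
  by move=> x _; rewrite lee_fin normal_pdf_ge0.
apply: ge0_le_integral => //.
- by move=> x _; rewrite -EFinM lee_fin mulr_ge0 ?sqr_ge0 ?normal_pdf_ge0.
- apply: emeasurable_funM => //.
  by apply/measurable_EFinP; exact: measurable_normal_pdf.
- exact: emeasurable_funM.
move=> x _; rewrite -!EFinM lee_fin !normal_pdfE // /normal_fun.
rewrite s2 subr0 expr1n.
have -> : C * (normal_peak s * expR (- x ^+ 2 / (2 *+ 2))) =
    normal_peak 1 * (4 * expR (- x ^+ 2 / (2 *+ 2))).
  by rewrite /C; field; rewrite gt_eqF // normal_peak_gt0.
rewrite mulrCA ler_wpM2l ?normal_peak_ge0 //.
(* The claim becomes u exp(-u) <= 1, a consequence of 1 + u <= exp u. *)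
pose u := x ^+ 2 / 4.
have -> : - x ^+ 2 / (1 *+ 2) = - u - u by rewrite /u mulr2n; field.
have -> : - x ^+ 2 / (2 *+ 2) = - u by rewrite /u mulr2n; field.
have -> : x ^+ 2 = 4 * u by rewrite /u; field.
rewrite expRD -mulrA ler_wpM2l // mulrA ler_piMl ?expR_ge0 //.
rewrite expRN ler_pdivrMr ?expR_gt0 // mul1r.
by have := expR_ge1Dx u; lra.
Qed.

(** [V] is the second moment of the standard normal law, left unevaluated: the deviation [t] in the
    final argument is tuned to it. The mean equals its own opposite because f and -f have the same
    law. *)
Lemma std_normal_moments : exists2 V : R, 0 <= V &
  forall d (T : measurableType d) (P : probability T R) (f : T -> R),
    measurable_fun [set: T] f ->
    (forall B, measurable B -> P [set w | B (f w)] = N01 B) ->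
  [/\ P.-integrable [set: T] (EFin \o f),
      P.-integrable [set: T] (EFin \o (fun w => f w ^+ 2)),
      \int[P]_w f w = 0 & \int[P]_w (f w ^+ 2) <= V].
Proof.
pose V := fine (\int[N01]_x ((x ^+ 2)%:E)).
exists V; first by apply: fine_ge0; apply: integral_ge0 => x _; rewrite lee_fin sqr_ge0.
move=> d T P f mf fN.
have mx2 : measurable_fun setT (fun x : measurableTypeR R => (x ^+ 2)%:E).
  by apply/measurable_EFinP; exact: measurable_funX.
have E2 : (\int[P]_w ((f w ^+ 2)%:E) = \int[N01]_x ((x ^+ 2)%:E))%E.
  transitivity (\int[pushforward P (f : T -> measurableTypeR R)]_x ((x ^+ 2)%:E))%E.
    rewrite ge0_integral_pushforward // => x _.
    by rewrite lee_fin sqr_ge0.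
  by apply: eq_measure_integral => //= B mB _; exact: fN.
have f2 : P.-integrable [set: T] (EFin \o (fun w => f w ^+ 2)).
  apply/integrableP; split; first by apply/measurable_EFinP; exact: measurable_funX.
  under eq_integral do rewrite /= ger0_norm ?sqr_ge0 //.
  by rewrite E2 std_normal_second_moment.
have fi : P.-integrable [set: T] (EFin \o f).
  apply: intg_le (intgD (intg_cst P 1) f2) => // w.
  rewrite -[f w ^+ 2]real_normK ?num_real //.
  by have := sqr_ge0 (`|f w| - 1); have := normr_ge0 (f w); nra.
split => //; last by rewrite /Rintegral E2.
have mN : measurable_fun [set: T] (fun w => - f w) by exact: measurable_funN.
have : \int[P]_w (- f w) = \int[P]_w f w.
  have ident (A : set R) : measurable A ->
      P ((fun w => - f w) @^-1` A) = P (f @^-1` A).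
    move=> mA; rewrite [RHS](fN _ mA) -(std_normal_prob_opp mA).
    apply: (fN (-%R @^-1` A)); rewrite -[X in measurable X]setTI.
    exact: measurable_funN.
  exact: (ident_Ex mN mf (@measurable_id _ _ _) ident).
under eq_Rintegral do rewrite -mulN1r.
by rewrite ExZ //; lra.
Qed.

End NormalMoments.

(** * The model *)

Lemma cV_norm_ge (R : realType) k (x : 'cV[R]_k) (j : 'I_k) : `|x j 0| <= `|x|.
Proof.
have -> : `|x| = mx_norm x by [].
rewrite mx_normrE.
exact: (le_bigmax _ (fun ij : 'I_k * 'I_1 => `|x ij.1 ij.2|) (j, 0)).
Qed.

Lemma cV_norm_attained (R : realType) k (x : 'cV[R]_k) : (0 < k)%N ->
  exists j, `|x| = `|x j 0|.
Proof.
move=> k0; have [->|x0] := eqVneq x 0.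
  by exists (Ordinal k0); rewrite mxE !normr0.
have : mx_norm x != 0 by apply: contra x0 => /eqP /mx_norm_eq0 ->.
move=> /mx_norm_neq0 [[i j] /= E]; exists i.
by rewrite [LHS]E (ord1 j).
Qed.

Lemma invmx_diag (R : fieldType) k (D : 'rV[R]_k) : (forall j, D 0 j != 0) ->
  invmx (diag_mx D) = diag_mx (\row_j (D 0 j)^-1).
Proof.
move=> D0; have DV : diag_mx D *m diag_mx (\row_j (D 0 j)^-1) = 1%:M.
  rewrite mulmx_diag; apply/matrixP => i j; rewrite !mxE.
  by rewrite divff.
have [uD _] := mulmx1_unit DV.
by rewrite -[RHS]mul1mx -(mulVmx uD) -mulmxA DV mulmx1.
Qed.

(** For a symmetric root B, the squared norm of row i is the (i, i) entry of B B = A. The form with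
    an absolute value also covers the default [0] of [sqrtmx]. *)
Lemma sqrtmx_row (R : realType) k (A : 'M[R]_k) (i : 'I_k) :
  \sum_j sqrtmx A i j ^+ 2 <= `|A i i|.
Proof.
rewrite /sqrtmx; case: xgetP => [B -> [[Bt _] BB]|_]; last first.
  by rewrite big1 // => j _; rewrite mxE expr0n.
rewrite -[in leRHS]BB mxE; apply: le_trans (ler_norm _).
rewrite le_eqVlt; apply/orP; left; apply/eqP; apply: eq_bigr => j _.
by rewrite expr2 -[in X in _ = _ * X]Bt mxE.
Qed.

Section ModelProbability.
Context disp (Omega : measurableType disp) (R : realType).
Context (P : probability Omega R).

Lemma mutually_independent_pair d' (T' : measurableType d') (I : finType)
    (Y : I -> Omega -> T') : mutually_independent P Y ->
  forall i l, i != l -> forall A C : set T', measurable A -> measurable C ->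
  P (Y i @^-1` A `&` Y l @^-1` C) = (P (Y i @^-1` A) * P (Y l @^-1` C))%E.
Proof.
move=> ind i l il A C mA mC.
have := ind [set i; l]%SET (fun u => if u == i then A else C).
rewrite big_setU1 ?inE // big_set1 eqxx eq_sym (negbTE il) => <-; last first.
  by move=> u; case: ifP.
congr (P _); apply/seteqP; split=> w /=.
  move=> [Yi Yl] u /=; rewrite !inE => /orP[]/eqP ->; first by rewrite eqxx.
  by rewrite eq_sym (negbTE il).
move=> h; split.
  by have := h i; rewrite /= !inE eqxx /=; apply.
by have := h l; rewrite /= !inE eqxx orbT eq_sym (negbTE il); apply.
Qed.

Lemma measurable_coord k (Y : rvec Omega R k) (j : 'I_k) :
  measurable_fun [set: Omega] (fun w => tnth (Y w) j).
Proof. by apply: (measurableT_comp (measurable_tnth j)). Qed.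

Lemma measurable_hyperrectangle k (H : set 'cV[R]_k) (f : Omega -> 'cV[R]_k) :
  hyperrectangle H -> (forall j, measurable_fun [set: Omega] (fun w => f w j 0)) ->
  measurable [set w | H (f w)].
Proof.
move=> [a [b [_ ->]]] mf.
have -> : [set w | [set x : 'cV[R]_k | forall j, (a j <= (x j 0)%:E <= b j)%E] (f w)] =
    \bigcap_(j in [set: 'I_k]) [set w | (a j <= (f w j 0)%:E <= b j)%E].
  by apply/seteqP; split=> w /= h j; [move=> _; exact: h|exact: h].
apply: fin_bigcap_measurable; first exact: finite_finset.
move=> j _.
have mE : measurable_fun [set: Omega] (fun w => (f w j 0)%:E).
  exact/measurable_EFinP.
have -> : [set w | (a j <= (f w j 0)%:E <= b j)%E] =
    ([set: Omega] `&` [set w | (a j <= (f w j 0)%:E)%E]) `&`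
    ([set: Omega] `&` [set w | ((f w j 0)%:E <= b j)%E]).
  apply/seteqP; split=> w /=; first by move=> /andP[h1 h2]; split.
  by move=> [[_ ->] [_ ->]].
apply: measurableI.
  exact: emeasurable_fun_c_infty.
exact: emeasurable_fun_infty_c.
Qed.

Section Coordinate.
Context k (Y : rvec Omega R k) (j : 'I_k) (m : R).
Context (m_gt2 : 2 < m).
Context (Ym : ('E_P[fun w => (`|tnth (Y w) j| `^ m)%R] < +oo)%E).

Lemma moment_intg :
  P.-integrable [set: Omega] (EFin \o (fun w => `|tnth (Y w) j| `^ m)).
Proof.
apply/integrableP; split.
  by apply/measurable_EFinP; apply: measurable_norm_powR; exact: measurable_coord.
move: Ym; rewrite unlock; apply: le_lt_trans.
rewrite le_eqVlt; apply/orP; left; apply/eqP; apply: eq_integral => w _ /=.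
by rewrite ger0_norm ?powR_ge0.
Qed.

Lemma meanE : mean P Y j 0 = \int[P]_w tnth (Y w) j.
Proof. by rewrite mxE fine_expectation. Qed.

Lemma cmoment_le b2 : 0 <= b2 -> cmoment P Y m j <= b2 ->
  \int[P]_w (`|tnth (Y w) j - mean P Y j 0| `^ m) <= b2 `^ m.
Proof.
rewrite /cmoment fine_expectation; set x := \int[P]_w _ => b20 h.
have x0 : 0 <= x by apply: Rintegral_ge0 => w _; exact: powR_ge0.
have m0 : m != 0 by move: m_gt2 => ?; rewrite gt_eqF //; lra.
rewrite -[x](powRr1 x0) -(mulVf m0) powRrM ge0_ler_powR ?nnegrE ?powR_ge0 //.
by move: m_gt2 => ?; lra.
Qed.

Lemma cmoment2E : cmoment P Y 2 j =
  Num.sqrt (\int[P]_w ((tnth (Y w) j - mean P Y j 0) ^+ 2)).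
Proof.
rewrite /cmoment fine_expectation powR12_sqrt.
  congr Num.sqrt; apply: eq_Rintegral => w _.
  by rewrite powR_mulrn // real_normK ?num_real.
by apply: Rintegral_ge0 => w _; exact: powR_ge0.
Qed.

Lemma covmxE : covmx P Y j j = \int[P]_w ((tnth (Y w) j - mean P Y j 0) ^+ 2).
Proof.
rewrite mxE unlock fine_expectation; apply: eq_Rintegral => w _.
by rewrite mxE expr2.
Qed.

End Coordinate.

Lemma cormx_diag k (Y : rvec Omega R k) (j : 'I_k) :
  (forall i, 0 < cmoment P Y 2 i) -> cormx P Y j j = 1.
Proof.
move=> s0; rewrite /cormx /sdmx invmx_diag; last first.
  by move=> i; rewrite mxE gt_eqF.
rewrite mul_mx_diag mul_diag_mx !mxE; have sj := s0 j.
rewrite -[X in _ * X / _ = _]/(fine _).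
have := covmxE Y j; rewrite mxE => ->.
have -> : \int[P]_w (tnth (Y w) j - mean P Y j 0) ^+ 2 = cmoment P Y 2 j ^+ 2.
  rewrite cmoment2E sqr_sqrtr //; apply: Rintegral_ge0 => w _; exact: sqr_ge0.
by field; rewrite gt_eqF.
Qed.

Lemma standardized_mean k (Y : rvec Omega R k) (j : 'I_k) :
  (forall i, 0 < cmoment P Y 2 i) ->
  (invmx (sdmx P Y) *m mean P Y) j 0 = mean P Y j 0 / cmoment P Y 2 j.
Proof.
move=> s0; rewrite /sdmx invmx_diag; last by move=> i; rewrite mxE gt_eqF.
by rewrite mul_diag_mx [LHS]mxE 2!mxE mulrC.
Qed.

End ModelProbability.

(** Dimension enters only through the Euclidean norm of [a], which will be at most 1. *)
Lemma gaussian_concentration (R : realType) : exists2 V : R, 0 <= V &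
  forall disp (Omega : measurableType disp) (P : probability Omega R) k
    (Z : rvec Omega R k), std_gaussian P Z ->
  forall (a : 'I_k -> R) (t : R), 0 < t ->
  (P [set w | (t <= `|\sum_i a i * tnth (Z w) i|)%R] <=
    (V * (\sum_i a i ^+ 2) / t ^+ 2)%:E)%E.
Proof.
have [V V0 moments] := std_normal_moments R.
exists V => // disp Omega P k Z [indep law] a t t0.
have mZ i := measurable_coord Z i.
have mom i := moments _ _ P _ (mZ i) (law i).
have := @chebyshev_sum _ _ _ P _ (index_enum 'I_k) a (fun i w => tnth (Z w) i) V t
  (index_enum_uniq _).
rewrite -mulr_suml mulrA; apply => //.
- by move=> i _; have [] := mom i.
- by move=> i _; have [] := mom i.
- move=> i l _ _ il.
  have [Zi Zi2 EZi _] := mom i; have [Zl Zl2 _ _] := mom l.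
  rewrite Ex_indep_mul ?EZi ?mul0r //.
    exact: (mutually_independent_pair indep il).
  exact: intgM.
Qed.

(** * Rates *)

Section Asymptotics.
Context (R : realType) (N L h : nat -> R) (m : R).
Context (m_gt2 : 2 < m).
Context (N_ge1 : forall k, 1 <= N k) (L_ge : forall k, ln 2 <= L k).
Context (h_ge0 : forall k, 0 <= h k).
Context (N_dvg : forall M, \forall k \near \oo, M <= N k).
Context (h_small : Num.sqrt (N k * L k) * h k `^ (1 - 1 / m) @[k --> \oo] --> (0 : R)).
Context (L_small : L k / N k `^ ((m - 2) / (5 * m - 2)) @[k --> \oo] --> (0 : R)).
(** The exponent of the dimension condition. With N = n, L = log d and h = eta along the
    subsequence, [ell] is log(d n). Both L and log N are o(N ^ q), so ell <= N ^ q eventually, and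
    the logarithmic terms below reduce to powers of N. *)
Let q := (m - 2) / (5 * m - 2).
Let ell k := L k + ln (N k).

Let N_gt0 k : 0 < N k. Proof. exact: lt_le_trans ltr01 (N_ge1 k). Qed.
Let L_gt0 k : 0 < L k.
Proof. by apply: lt_le_trans (L_ge k); rewrite ln_gt0 // ltr1n. Qed.

Let powR_ND a b k : N k `^ (a + b) = N k `^ a * N k `^ b.
Proof. by rewrite powRD //; apply/implyP => _; rewrite gt_eqF. Qed.

Lemma cvg0_near (u : nat -> R) (e : R) : u k @[k --> \oo] --> (0 : R) -> 0 < e ->
  \forall k \near \oo, u k <= e.
Proof.
move=> /cvgr0Pnorm_le h1 e0; have := h1 _ e0; apply: filterS => k.
by apply: le_trans; exact: ler_norm.
Qed.

Lemma powR_dvg a M : 0 < a -> \forall k \near \oo, M <= N k `^ a.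
Proof.
move=> a0; have := N_dvg (Num.max M 0 `^ a^-1); apply: filterS => k hk.
have M0 : 0 <= Num.max M 0 by rewrite le_max lexx orbT.
apply: (@le_trans _ _ (Num.max M 0)); first by rewrite le_max lexx.
have an0 : a != 0 by rewrite gt_eqF.
rewrite -[leLHS](powRr1 M0) -(mulVf an0) powRrM.
by rewrite ge0_ler_powR ?nnegrE ?powR_ge0 // ltW.
Qed.

Lemma powR_cvg0_neg z e : z < 0 -> 0 < e -> \forall k \near \oo, N k `^ z <= e.
Proof.
move=> z0 e0; have z1 : 0 < - z by rewrite oppr_gt0.
have := powR_dvg e^-1 z1; apply: filterS => k.
by rewrite powRN lef_pV2 ?posrE // powR_gt0.
Qed.

(** With x = N ^ (a / 2), ln N = (2 / a) ln x <= (2 / a) x, and a second factor x outgrows 2 / (a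
    e). *)
Lemma ln_le_powR a e : 0 < a -> 0 < e -> \forall k \near \oo, ln (N k) <= e * N k `^ a.
Proof.
move=> a0 e0; have a20 : 0 < a / 2 by rewrite divr_gt0.
have := powR_dvg (2 / a / e) a20; apply: filterS => k hk.
have -> : a = a / 2 + a / 2 by field.
rewrite powR_ND.
have x0 : 0 < N k `^ (a / 2) by exact: powR_gt0.
set x := N k `^ (a / 2) in hk x0 *.
have lnx : ln (N k) = 2 / a * ln x.
  by rewrite /x ln_powR; field; rewrite gt_eqF.
rewrite lnx; apply: (@le_trans _ _ (2 / a * x)).
  rewrite ler_wpM2l ?divr_ge0 ?(ltW a0) //.
  by have := expR_ge1Dx (ln x); rewrite lnK ?posrE //; lra.
by rewrite mulrA ler_pM2r // -ler_pdivrMl // mulrC.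
Qed.

Let q_gt0 : 0 < q.
Proof. by move: m_gt2 => ?; rewrite /q divr_gt0 //; lra. Qed.

Let ell_ge0 k : 0 <= ell k.
Proof. by rewrite addr_ge0 ?ln_ge0 // ltW. Qed.

Let ell_le : \forall k \near \oo, ell k <= N k `^ q.
Proof.
have h2 : 0 < (2^-1 : R) by [].
apply: filterS2 (cvg0_near L_small h2) (ln_le_powR q_gt0 h2) => k.
rewrite ler_pdivrMr ?powR_gt0 // -/q => h3 h4; rewrite /ell; lra.
Qed.

Let ellN_le : \forall k \near \oo, ell k / N k <= N k `^ (q - 1).
Proof.
apply: filterS ell_le => k hk; rewrite ler_pdivrMr //.
by rewrite -[X in _ * X](powRr1 (ltW (N_gt0 k))) -powR_ND subrK.
Qed.

Let ellN_powR p : 0 < p ->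
  \forall k \near \oo, (ell k / N k) `^ p <= N k `^ ((q - 1) * p).
Proof.
move=> p0; apply: filterS ellN_le => k hk.
by rewrite powRrM ge0_ler_powR ?nnegrE ?divr_ge0 ?powR_ge0 // ltW.
Qed.

(** [L] is bounded below by ln 2, so the factor sqrt L of [h_small] can be divided out. *)
Let sqrtN_h e : 0 < e ->
  \forall k \near \oo, Num.sqrt (N k) * h k `^ (1 - 1 / m) <= e.
Proof.
move=> e0; have l0 : 0 < Num.sqrt (ln 2 : R) by rewrite sqrtr_gt0 ln_gt0 // ltr1n.
apply: filterS (cvg0_near h_small (mulr_gt0 e0 l0)) => k.
rewrite sqrtrM ?(ltW (N_gt0 k)) // => hk.
have : Num.sqrt (N k) * h k `^ (1 - 1 / m) * Num.sqrt (ln 2) <= e * Num.sqrt (ln 2).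
  apply: le_trans hk; rewrite -mulrA [leRHS]mulrAC [leRHS]mulrC [leRHS]mulrC.
  rewrite -[leRHS]mulrA ler_wpM2l ?sqrtr_ge0 // ler_wpM2l ?powR_ge0 //.
  by rewrite ler_wsqrtr.
by rewrite ler_pM2r.
Qed.

Let h_le e : 0 < e -> \forall k \near \oo, h k <= e.
Proof.
move: m_gt2 => m2 e0; have p0 : 0 < 1 - 1 / m by rewrite subr_gt0 ltr_pdivrMr; lra.
apply: filterS (sqrtN_h (powR_gt0 (1 - 1 / m) e0)) => k hk.
rewrite leNgt; apply/negP => he.
have : e `^ (1 - 1 / m) < h k `^ (1 - 1 / m).
  by rewrite gt0_ltr_powR ?nnegrE // ltW.
have N1 : 1 <= Num.sqrt (N k) by rewrite -sqrtr1 ler_wsqrtr.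
have := powR_ge0 (h k) (1 - 1 / m); nra.
Qed.

Let ellN_small e : 0 < e -> \forall k \near \oo, ell k / N k <= e.
Proof.
move: m_gt2 => m2 e0.
have q1 : q - 1 < 0 by rewrite subr_lt0 /q ltr_pdivrMr; lra.
by apply: filterS2 ellN_le (powR_cvg0_neg q1 e0) => k; exact: le_trans.
Qed.

Lemma level_small l1 l2 e : 0 < l1 -> 0 < l2 -> 0 < e ->
  \forall k \near \oo, l1 * h k + l2 * (ell k / N k) <= e.
Proof.
move=> l10 l20 e0; have e20 : 0 < e / 2 by rewrite divr_gt0.
have a1 := h_le (divr_gt0 e20 l10); have a2 := ellN_small (divr_gt0 e20 l20).
apply: filterS2 a1 a2 => k; rewrite !ler_pdivlMr // => b1 b2.
rewrite [l1 * _]mulrC [l2 * _]mulrC; lra.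
Qed.

(** By (x + y) ^ p <= (2 x) ^ p + (2 y) ^ p the two parts of the level separate: contamination is
    controlled by [h_small], the logarithmic part by a negative power of N. *)
Lemma sqrt_level_small l1 l2 e : 0 < l1 -> 0 < l2 -> 0 < e ->
  \forall k \near \oo,
    Num.sqrt (N k) * (l1 * h k + l2 * (ell k / N k)) `^ (1 - 1 / m) <= e.
Proof.
move: m_gt2 => m2 l10 l20 e0; pose p := 1 - 1 / m.
have p0 : 0 < p by rewrite /p subr_gt0 ltr_pdivrMr; lra.
(* The exponent bounding sqrt N (ell / N) ^ p; it equals -3 (m - 2) / (2 (5m - 2)). *)
have z0 : 2^-1 + (q - 1) * p < 0.
  have -> : 2^-1 + (q - 1) * p = (2 - m) * 3 / (2 * (5 * m - 2)) .
    by rewrite /q /p; field; apply/andP; split; rewrite gt_eqF //; lra.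
  rewrite ltr_pdivrMr ?mul0r; first by lra.
  by rewrite mulr_gt0 //; lra.
pose c1 := (2 * l1) `^ p; pose c2 := (2 * l2) `^ p.
have c10 : 0 < c1 by rewrite powR_gt0 // mulr_gt0.
have c20 : 0 < c2 by rewrite powR_gt0 // mulr_gt0.
have e20 : 0 < e / 2 by rewrite divr_gt0.
have a1 := sqrtN_h (divr_gt0 e20 c10); have a2 := ellN_powR p0.
have a3 := powR_cvg0_neg z0 (divr_gt0 e20 c20).
apply: filterS3 a1 a2 a3 => k b1 b2 b3; rewrite -/p.
set x := l1 * h k; set y := l2 * _.
have x0 : 0 <= x by rewrite mulr_ge0 // ltW.
have y0 : 0 <= y by rewrite mulr_ge0 ?divr_ge0 // ltW.
have h1 : (x + y) `^ p <= c1 * h k `^ p + c2 * (ell k / N k) `^ p.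
  rewrite /c1 /c2 -!powRM ?divr_ge0 ?(ltW (N_gt0 k)) //; try by rewrite mulr_ge0 // ltW.
  rewrite -!mulrA -/x -/y; have xy0 : 0 <= x + y by rewrite addr_ge0.
  have x20 : 0 <= 2 * x by rewrite mulr_ge0.
  have y20 : 0 <= 2 * y by rewrite mulr_ge0.
  case: (leP x y) => xy.
    apply: (@le_trans _ _ ((2 * y) `^ p)); last by rewrite lerDr powR_ge0.
    by rewrite ge0_ler_powR ?nnegrE ?(ltW p0) //; lra.
  apply: (@le_trans _ _ ((2 * x) `^ p)); last by rewrite lerDl powR_ge0.
  by rewrite ge0_ler_powR ?nnegrE ?(ltW p0) //; lra.
apply: (@le_trans _ _ (Num.sqrt (N k) * (c1 * h k `^ p + c2 * (ell k / N k) `^ p))).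
  by rewrite ler_wpM2l ?sqrtr_ge0.
rewrite mulrDr.
have : Num.sqrt (N k) * (c1 * h k `^ p) <= e / 2.
  by move: b1; rewrite ler_pdivlMr // -/p; lra.
have : Num.sqrt (N k) * (c2 * (ell k / N k) `^ p) <= e / 2.
  move: b3; rewrite ler_pdivlMr // => b3; apply: le_trans b3.
  rewrite powR_ND.
  rewrite powR12_sqrt ?(ltW (N_gt0 k)) // -mulrA ler_wpM2l ?sqrtr_ge0 //.
  by rewrite mulrC ler_pM2r.
lra.
Qed.

Lemma rate_small e : 0 < e -> \forall k \near \oo,
  (h k `^ (1 - 2 / m) + (ell k / N k) `^ (1 - (Num.min (m / 2) 2)^-1)) * L k <= e.
Proof.
move: m_gt2 => m2 e0; have e20 : 0 < e / 2 by rewrite divr_gt0.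
pose p := 1 - 1 / m; pose r := 1 - (Num.min (m / 2) 2)^-1.
have p0 : 0 < p by rewrite /p subr_gt0 ltr_pdivrMr; lra.
have m1 : 0 < m - 1 by lra.
have m5 : 0 < 5 * m - 2 by lra.
(* The exponent bounding h ^ (1 - 2/m) L: h ^ (1 - 2/m) is the power (m - 2) / (m - 1) of h ^ (1 -
   1/m), which is at most N ^ (-1/2). *)
have z1 : - (2^-1 * ((m - 2) / (m - 1))) + q < 0.
  have -> : - (2^-1 * ((m - 2) / (m - 1))) + q =
      - (3 * m * (m - 2)) / (2 * (m - 1) * (5 * m - 2)).
    by rewrite /q; field; apply/andP; split; rewrite gt_eqF.
  rewrite ltr_pdivrMr ?mul0r; last by rewrite !mulr_gt0.
  by rewrite oppr_lt0 !mulr_gt0 //; lra.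
have r0 : 0 < r.
  rewrite /r subr_gt0 invf_lt1; last by rewrite lt_min; apply/andP; split; lra.
  by rewrite lt_min; apply/andP; split; lra.
(* The exponent bounding (ell / N) ^ r L; the minimum in [r] changes branch at m = 4. *)
have z2 : (q - 1) * r + q < 0.
  rewrite /r; case: (leP (m / 2) 2) => hm.
    have -> : (q - 1) * (1 - (m / 2)^-1) + q = - (3 * (m - 2)) / (5 * m - 2).
      by rewrite /q; field; apply/andP; split; rewrite gt_eqF //; lra.
    by rewrite ltr_pdivrMr // mul0r; lra.
  have -> : (q - 1) * (1 - 2^-1) + q = - (m + 2) / (5 * m - 2).
    by rewrite /q; field; rewrite gt_eqF //; lra.
  by rewrite ltr_pdivrMr // mul0r; lra.
have L_le : \forall k \near \oo, L k <= N k `^ q.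
  apply: filterS ell_le => k; apply: le_trans.
  by rewrite lerDl ln_ge0.
have H1 : \forall k \near \oo, h k `^ (1 - 2 / m) * L k <= e / 2.
  apply: filterS3 (sqrtN_h ltr01) L_le (powR_cvg0_neg z1 e20) => k b1 b2 b3.
  apply: le_trans b3; rewrite powR_ND.
  rewrite ler_pM ?powR_ge0 ?(ltW (L_gt0 k)) //.
  have -> : 1 - 2 / m = (1 - 1 / m) * ((m - 2) / (m - 1)).
    by field; apply/andP; split; rewrite gt_eqF //; lra.
  have w0 : 0 <= (m - 2) / (m - 1) by rewrite divr_ge0; lra.
  set w := (m - 2) / (m - 1) in w0 *.
  have -> : - (2^-1 * w) = - 2^-1 * w by rewrite mulNr.
  rewrite (powRrM (h k)) (powRrM (N k)) ge0_ler_powR ?nnegrE ?powR_ge0 //.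
  rewrite powRN powR12_sqrt ?(ltW (N_gt0 k)) //.
  by rewrite -[leRHS]mul1r ler_pdivlMr ?sqrtr_gt0 // mulrC.
have H2 : \forall k \near \oo, (ell k / N k) `^ r * L k <= e / 2.
  apply: filterS3 (ellN_powR r0) L_le (powR_cvg0_neg z2 e20) => k b1 b2 b3.
  apply: le_trans b3; rewrite powR_ND.
  by rewrite ler_pM ?powR_ge0 ?(ltW (L_gt0 k)).
by apply: filterS2 H1 H2 => k; rewrite -/r mulrDl; lra.
Qed.

(** The assumed lower bound [c0] applies to (sqrt N mu / sqrt L) (rate L); once rate L <= c0 / M,
    the first factor is at least M. *)
Lemma signal_dominates (mu : nat -> R) (c0 : R) : (forall k, 0 <= mu k) -> 0 < c0 ->
  (\forall k \near \oo, c0 <= Num.sqrt (N k * L k) *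
    (h k `^ (1 - 2 / m) + (ell k / N k) `^ (1 - (Num.min (m / 2) 2)^-1)) * mu k) ->
  forall M, 0 < M -> \forall k \near \oo,
    M * Num.sqrt (L k) <= Num.sqrt (N k) * mu k.
Proof.
move=> mu0 c00 hc M M0.
apply: filterS2 hc (rate_small (divr_gt0 c00 M0)) => k.
set rt := _ `^ _ + _ => h1 h2; have Lk := L_gt0 k.
have sL : 0 < Num.sqrt (L k) by rewrite sqrtr_gt0.
have LE : L k = Num.sqrt (L k) * Num.sqrt (L k) by rewrite -expr2 sqr_sqrtr // ltW.
move: h1 h2; rewrite sqrtrM ?(ltW (N_gt0 k)) // ler_pdivlMr // => h1 h2.
have sm : 0 <= Num.sqrt (N k) * mu k by rewrite mulr_ge0 ?sqrtr_ge0.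
set v := Num.sqrt (N k) * mu k in sm *.
have h3 : c0 <= v * Num.sqrt (L k) * rt by rewrite /v; lra.
have h4 : c0 * L k * M <= v * Num.sqrt (L k) * c0.
  apply: (@le_trans _ _ (v * Num.sqrt (L k) * (rt * L k * M))).
    have -> : v * Num.sqrt (L k) * (rt * L k * M) = v * Num.sqrt (L k) * rt * (L k * M).
      by ring.
    by rewrite -mulrA ler_wpM2r // mulr_ge0 // ltW.
  by rewrite ler_wpM2l // mulr_ge0 // ltW.
have : c0 * Num.sqrt (L k) * (M * Num.sqrt (L k)) <= c0 * Num.sqrt (L k) * v.
  by move: h4; rewrite {1}LE; lra.
by rewrite ler_pM2l // mulr_gt0.
Qed.

End Asymptotics.

(** * Escape from bounded boxes *)

(** Take T ^ m = c / e with c = (K + 1) / kap. The margin gives T ^ m (e - eta) >= K + 1; also e T =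
    c ^ (1/m) e ^ (1 - 1/m), and c >= 1 makes T ^ (1 - m) <= e ^ (1 - 1/m). Finally e T ^ 2 <= e T ^
    m = c. *)
Lemma truncation_level (R : realType) (m K kap e eta : R) :
    2 < m -> 0 < K -> 0 < kap <= 1 -> 0 < e <= 1 -> kap * e <= e - eta ->
  exists T, [/\ 1 <= T, K < T `^ m * (e - eta),
    6 * e * T + K / T `^ (m - 1) <=
      (6 * ((K + 1) / kap) `^ m^-1 + K) * e `^ (1 - 1 / m) &
    e * T ^+ 2 <= (K + 1) / kap].
Proof.
move=> m2 K0 /andP[kap0 kap1] /andP[e0 e1] ee.
have m0 : m != 0 by rewrite gt_eqF //; lra.
set c := (K + 1) / kap.
have c1 : 1 <= c by rewrite ler_pdivlMr //; lra.
have c0 : 0 < c by lra.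
have ce0 : 0 < c / e by rewrite divr_gt0.
pose T := (c / e) `^ m^-1; exists T.
have T0 : 0 < T by exact: powR_gt0.
have Tm : T `^ m = c / e by rewrite /T -powRrM mulVf // powRr1 // ltW.
have im0 : 0 <= m^-1 by rewrite invr_ge0; lra.
have T1 : 1 <= T.
  rewrite -(powRr0 (c / e)) /T ler_powR //.
  by rewrite ler_pdivlMr // mul1r; lra.
have eV : e^-1 = e `^ (-1) by rewrite powR_inv1 // ltW.
have e_ne0 : e != 0 by rewrite gt_eqF.
split => //.
- rewrite Tm; apply: (@lt_le_trans _ _ (c / e * (kap * e))).
    have -> : c / e * (kap * e) = K + 1 by rewrite /c; field; rewrite !gt_eqF.
    lra.
  by rewrite ler_wpM2l // ltW.
- have eT : e * T = c `^ m^-1 * e `^ (1 - 1 / m).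
    rewrite /T powRM ?(ltW c0) ?invr_ge0 ?(ltW e0) // eV -powRrM mulrCA.
    congr (_ * _); rewrite -{1}(powRr1 (ltW e0)) -powRD; last by rewrite e_ne0 implybT.
    by congr powR; field.
  have KT : K / T `^ (m - 1) <= K * e `^ (1 - 1 / m).
    rewrite ler_pM2l // -[leRHS]invrK lef_pV2 ?posrE ?invr_gt0 ?powR_gt0 //.
    have -> : (e `^ (1 - 1 / m))^-1 = e^-1 `^ (1 - 1 / m).
      by rewrite eV -powRrM mulN1r powRN.
    have -> : T `^ (m - 1) = (c / e) `^ (1 - 1 / m).
      by rewrite /T -powRrM; congr powR; field.
    rewrite ge0_ler_powR ?nnegrE ?invr_ge0 ?(ltW e0) ?(ltW ce0) //.
      by rewrite subr_ge0 ler_pdivrMr; lra.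
    by rewrite ler_peMl // invr_ge0 ltW.
  by rewrite -mulrA eT; lra.
- apply: (@le_trans _ _ (e * T `^ m)).
    by rewrite ler_pM2l // -powR_mulrn ?(ltW T0) // ler_powR // ltW.
  by rewrite Tm mulrCA divff // mulr1.
Qed.

(** Outside the exceptional event the drift forces coordinate [j] of the statistic beyond [rho],
    hence out of [H]. The variance bound b1 ^ 2 and the moment bound b2 ^ m fix [p0] for all laws of
    the model. *)
Lemma winsorized_stat_tail (R : realType) (m b1 b2 : R) : 2 < m -> 0 < b1 -> 0 < b2 ->
  exists2 p0 : R, 0 < p0 & forall disp (Omega : measurableType disp)
    (P : probability Omega R) (n k : nat) (X Xt : nat -> rvec Omega R k)
    (SW : rvec Omega R k) (j : 'I_k) (e e' eta kap K rho : R) (H : set 'cV[R]_k),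
  (0 < n)%N -> iid P n X ->
  (forall w, (count (fun i => Xt i w != X i w) (index_iota 1 n.+1))%:R <= eta * n%:R) ->
  ('E_P[fun w => (`|tnth (X 1%N w) j| `^ m)%R] < +oo)%E ->
  b1 <= cmoment P (X 1%N) 2 j -> cmoment P (X 1%N) m j <= b2 ->
  (forall w, winsorized_stat e e' n (fun i => Xt i w) (SW w)) ->
  0 < e < 1 / 2 -> 0 < e' < 1 / 2 -> 6 * e' < p0 -> 0 < kap <= 1 -> 0 <= eta ->
  kap * e <= e - eta -> kap * e' <= e' - eta -> 0 < K ->
  hyperrectangle H -> (forall x, H x -> `|x j 0| <= rho) ->
  rho * Num.sqrt (3 * ((K + 1) / kap) + 1 + K) <
    Num.sqrt n%:R * `|mean P (X 1%N) j 0| - K -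
    (6 * ((K + 1) / kap) `^ m^-1 + K) * (Num.sqrt n%:R * e `^ (1 - 1 / m)) ->
  (P [set w | H (vec (SW w))] <=
    (b2 `^ m / K + (1 + b2 `^ m) / K ^+ 2 + 4 / (n%:R * p0 ^+ 2))%:E)%E.
Proof.
move=> m2 b10 b20.
have [p0 p00 conc] := iid_concentration m2 (exprn_gt0 2 b10) (powR_ge0 b2 m).
exists p0 => // disp Omega P n k X Xt SW j e e' eta kap K rho H n0 [indep ident].
move=> cont Xm sd2 sdm stat e01 e'01 e'p kap01 eta0 kape kape' K0 hH Hrho bound.
have N0 : 0 < n%:R :> R by rewrite ltr0n.
pose Y i w := tnth (X i w) j.
set mu := mean P (X 1%N) j 0 in bound *.
have muE : mu = \int[P]_w Y 1%N w by rewrite /mu meanE.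
have mtA (A : set R) : measurable A ->
    measurable ((fun t : k.-tuple R => tnth t j) @^-1` A).
  by move=> mA; rewrite -[X in measurable X]setTI; exact: measurable_tnth.
have Yindep i l : (1 <= i <= n)%N -> (1 <= l <= n)%N -> i != l ->
    forall A C : set R, measurable A -> measurable C ->
    P (Y i @^-1` A `&` Y l @^-1` C) = (P (Y i @^-1` A) * P (Y l @^-1` C))%E.
  case: i => // i; case: l => // l /andP[_ il] /andP[_ ll] ne A C mA mC.
  have ne' : Ordinal il != Ordinal ll.
    by apply: contra ne => /eqP /(congr1 val) /= ->.
  exact: (mutually_independent_pair indep ne' (mtA _ mA) (mtA _ mC)).
have Yident i : (1 <= i <= n)%N -> forall A : set R, measurable A ->
    P (Y i @^-1` A) = P (Y 1%N @^-1` A).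
  by move=> il A mA; exact: (ident i il _ (mtA _ mA)).
have Dle : \int[P]_w (`|Y 1%N w - \int[P]_w0 Y 1%N w0| `^ m) <= b2 `^ m.
  by rewrite -muE; exact: cmoment_le (ltW b20) sdm.
have Dge : b1 ^+ 2 <= \int[P]_w ((Y 1%N w - \int[P]_w0 Y 1%N w0) ^+ 2).
  rewrite -muE; move: sd2; rewrite cmoment2E -/mu; set x := \int[P]_w _ => sd2.
  have x0 : 0 <= x by apply: Rintegral_ge0 => w _; exact: sqr_ge0.
  by rewrite -(sqr_sqrtr x0) ler_sqr ?nnegrE ?sqrtr_ge0 // ltW.
have [E [mE PE good]] := conc _ _ P n Y n0 (fun i => measurable_coord (X i) j)
  Yindep Yident (moment_intg Xm) Dge Dle K K0.
apply: le_trans PE; apply: le_measure; rewrite ?inE //.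
  apply: measurable_hyperrectangle hH _ => l.
  by under eq_fun do rewrite mxE; exact: measurable_coord.
move=> w /= Hw; apply: contrapT => /good; rewrite -muE => -[g1 g2 g3 g4].
case/andP: (kap01) => kap0 kap1; case/andP: (e01) => e0 e1; case/andP: (e'01) => e'0 e'1.
have e_01 : 0 < e <= 1 by rewrite e0; move: e1; clear; lra.
have e'_01 : 0 < e' <= 1 by rewrite e'0; move: e'1; clear; lra.
have [T [T1 KT Tb _]] := truncation_level m2 K0 kap01 e_01 kape.
have [T' [T'1 KT' _ Tb']] := truncation_level m2 K0 kap01 e'_01 kape'.
have ke : 0 < kap * e by rewrite mulr_gt0.
have ke' : 0 < kap * e' by rewrite mulr_gt0.
have ee : eta <= e by move: ke kape; clear; lra.
have ee' : eta <= e' by move: ke' kape'; clear; lra.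
(* The p0 n / 2 clean observations on each side of the mean outnumber the 3 e' n bad indices, which
   excludes a zero normalization. *)
have p3 : 3 * e' * n%:R < p0 / 2 * n%:R by rewrite ltr_pM2r //; move: e'p; clear; lra.
have := @winsorized_stat_ge R k n (fun i => X i w) (fun i => Xt i w) j (SW w) mu
  m e e' eta K T T' n0 e01 e'01 ee ee' (cont w) m2 T1 T'1 KT KT' g1 g2
  (lt_le_trans p3 g3) (lt_le_trans p3 g4) (stat w).
apply/negP; rewrite -ltNge; apply: (@le_lt_trans _ _
    (rho * Num.sqrt (3 * ((K + 1) / kap) + 1 + K))).
  have := Hrho _ Hw; rewrite mxE => tr.
  apply: ler_pM => //; rewrite ?sqrtr_ge0 //.
  by rewrite ler_wsqrtr // -mulrA !lerD2r ler_pM2l.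
apply: lt_le_trans bound _; rewrite lerD2l lerN2 [leRHS]mulrCA.
by rewrite ler_wpM2l ?sqrtr_ge0.
Qed.

(** In coordinate [j] the drift is at least t + rho in absolute value, so membership in [H] forces
    the noise to be at least [t]. The noise weights have squared norm at most 1, the diagonal entry
    of the correlation matrix. *)
Lemma gaussian_tail (R : realType) : exists2 V : R, 0 <= V &
  forall disp (Omega : measurableType disp) (P : probability Omega R) (k : nat)
    (X Z : rvec Omega R k) (n : nat) (j : 'I_k) (s rho t : R) (H : set 'cV[R]_k),
  std_gaussian P Z -> (forall i, 0 < cmoment P X 2 i) -> cmoment P X 2 j <= s ->
  hyperrectangle H -> (forall x, H x -> `|x j 0| <= rho) -> 0 < t ->
  t + rho <= Num.sqrt n%:R * `|mean P X j 0| / s ->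
  (P [set w | H (sqrtmx (cormx P X) *m vec (Z w) +
      Num.sqrt n%:R *: (invmx (sdmx P X) *m mean P X))%R] <= (V / t ^+ 2)%:E)%E.
Proof.
have [V V0 conc] := gaussian_concentration R; exists V => //.
move=> disp Omega P k X Z n j s rho t H gZ sd0 sds hH Hrho t0 bound.
pose a i := sqrtmx (cormx P X) j i.
have coordE w i : (sqrtmx (cormx P X) *m vec (Z w) +
    Num.sqrt n%:R *: (invmx (sdmx P X) *m mean P X)) i 0 =
    \sum_l sqrtmx (cormx P X) i l * tnth (Z w) l +
    Num.sqrt n%:R * (mean P X i 0 / cmoment P X 2 i).
  rewrite -(standardized_mean i sd0) mxE; congr (_ + _); last by rewrite mxE.
  by rewrite mxE; apply: eq_bigr => l _; rewrite mxE.
have mS i : measurable_fun [set: Omega]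
    (fun w => \sum_l sqrtmx (cormx P X) i l * tnth (Z w) l).
  by apply: measurable_sum => l; apply: measurable_funM => //; exact: measurable_coord.
apply: (@le_trans _ _ (P [set w | (t <= `|\sum_i a i * tnth (Z w) i|)%R])).
  apply: le_measure; rewrite ?inE.
  - apply: measurable_hyperrectangle hH _ => i.
    under eq_fun do rewrite coordE.
    exact: measurable_funD.
  - by apply: measurable_ge; apply: measurableT_comp => //; exact: mS.
  move=> w /= /Hrho; rewrite coordE -/a; set u := \sum_i _; set v := _ * _ => uv.
  have vge : Num.sqrt n%:R * `|mean P X j 0| / s <= `|v|.
    rewrite /v normrM (ger0_norm (sqrtr_ge0 _)) -mulrA ler_wpM2l ?sqrtr_ge0 //.
    rewrite normrM ler_wpM2l // normfV gtr0_norm ?sd0 //.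
    by rewrite lef_pV2 ?posrE ?sd0 // (lt_le_trans (sd0 j) sds).
  have := ler_normB (u + v) u; rewrite addrAC subrr add0r; lra.
apply: le_trans (conc _ _ _ _ _ gZ _ _ t0) _; rewrite lee_fin.
rewrite ler_pM2r ?invr_gt0 ?exprn_gt0 // -[leRHS]mulr1 ler_wpM2l //.
apply: le_trans (sqrtmx_row _ _) _.
by rewrite cormx_diag // normr1.
Qed.

(** * From eventual bounds to limits, and the theorem *)

Lemma cvge0_le (R : realType) (u : nat -> \bar R) : (forall k, 0 <= u k)%E ->
  (forall e : R, 0 < e -> \forall k \near \oo, (u k <= e%:E)%E) ->
  u k @[k --> \oo] --> 0%E.
Proof.
move=> u0 ue; apply/fine_cvgP; split.
  apply: filterS (ue 1 ltr01) => k uk.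
  by rewrite ge0_fin_numE // (le_lt_trans uk) // ltry.
apply/cvgr0Pnorm_le => e e0; apply: filterS (ue e e0) => k uk.
rewrite ger0_norm ?fine_ge0 // -lee_fin fineK //.
by rewrite ge0_fin_numE // (le_lt_trans uk) // ltry.
Qed.

(** A real number strictly between 0 and [c] treats finite and infinite [c] alike. *)
Lemma cvge_gt_near (R : realType) (u : nat -> R) (c : \bar R) : (0 < c)%E ->
  (u k)%:E @[k --> \oo] --> c ->
  exists2 c0, 0 < c0 & \forall k \near \oo, c0 <= u k.
Proof.
move=> c0 uc; have [b b0 bc] : exists2 b : R, 0 < b & (b%:E < c)%E.
  case: c c0 {uc} => [r| |] //; last by exists 1; rewrite ?ltry.
  by rewrite lte_fin => r0; exists (r / 2); rewrite ?lte_fin; lra.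
exists b => //.
have near_u : \forall k \near \oo, (b%:E < (u k)%:E)%E := uc _ (open_ereal_gt' bc).
by apply: filterS near_u => k; rewrite lte_fin => /ltW.
Qed.

Theorem theoremB3 (R : realType) (disp : measure_display)
    (Omega : measurableType disp) (d : nat -> nat)
    (d_gt0 : forall n, (0 < d n)%N)
    (X Xt : forall n : nat, nat -> rvec Omega R (d n))
    (Z : forall k : nat, rvec Omega R k)
    (eta : nat -> R) (eta_bounds : forall n, 0 <= eta n < 1 / 2)
    (contamination : forall n, (0 < n)%N -> forall w : Omega,
       (count (fun i => Xt n i w != X n i w) (index_iota 1 n.+1))%:R
         <= eta n * n%:R)
    (b1 b2 m : R) (b1_gt0 : 0 < b1) (b1_lt_b2 : b1 < b2) (m_gt2 : 2 < m)
    (lam1 lam1' lam2 lam2' : R) (lam1_gt1 : 1 < lam1) (lam1'_gt1 : 1 < lam1')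
    (lam2_gt0 : 0 < lam2) (lam2'_gt0 : 0 < lam2')
    (SW : forall n : nat, rvec Omega R (d n))
    (SW_def : forall n, (0 < n)%N ->
       0 < eps lam1 lam2 (eta n) (d n) n < 1 / 2 ->
       0 < eps' lam1' lam2' (eta n) (d n) n < 1 / 2 ->
       forall w : Omega,
         winsorized_stat (eps lam1 lam2 (eta n) (d n) n)
           (eps' lam1' lam2' (eta n) (d n) n) n (fun i => Xt n i w) (SW n w))
    (P : nat -> probability Omega R)
    (P_in : forall n, (0 < n)%N -> model_class X Xt Z b1 b2 m (P n))
    (s : nat -> nat) (s_gt0 : forall k, (0 < s k)%N)
    (s_incr : forall i j, (i < j)%N -> (s i < s j)%N)
    (d_ge2 : forall k, (2 <= d (s k))%N)
    (cond_eta : Num.sqrt ((s k)%:R * ln (d (s k))%:R)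
                  * eta (s k) `^ (1 - 1 / m) @[k --> \oo] --> (0 : R))
    (cond_d : ln (d (s k))%:R / (s k)%:R `^ ((m - 2) / (5 * m - 2))
                @[k --> \oo] --> (0 : R))
    (c : \bar R) (c_gt0 : (0 < c)%E)
    (cond_mu : (Num.sqrt ((s k)%:R * ln (d (s k))%:R)
                  * rate (s k) (d (s k)) m (eta (s k))
                  * `|mean (P (s k)) (X (s k) 1%N)|)%:E @[k --> \oo] --> c)
    (Hs : forall n, set (set 'cV[R]_(d n)))
    (Hs_neq0 : forall k, Hs (s k) !=set0)
    (Hs_sub : forall k, Hs (s k) `<=` @hyperrectangle R (d (s k)))
    (Hs_radius : exists C : R, \forall k \near \oo,
       (ereal_sup [set `|x|%:E | x in \bigcup_(H in Hs (s k)) H]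
          <= (C * Num.sqrt (ln (d (s k))%:R))%:E)%E) :
  let G n (w : Omega) : 'cV[R]_(d n) :=
    sqrtmx (cormx (P n) (X n 1%N)) *m vec (Z (d n) w)
    + Num.sqrt n%:R *: (invmx (sdmx (P n) (X n 1%N)) *m mean (P n) (X n 1%N)) in
  (ereal_sup [set `|P (s k) [set w | H (vec (SW (s k) w))]
                    - P (s k) [set w | H (G (s k) w)]|%E | H in Hs (s k)]
     @[k --> \oo] --> 0%E) /\
  (forall H : (forall n, set 'cV[R]_(d n)),
     (forall k, Hs (s k) (H (s k))) ->
     (P (s k) [set w | H (s k) (vec (SW (s k) w))] @[k --> \oo] --> 0%E) /\
     (P (s k) [set w | H (s k) (G (s k) w)] @[k --> \oo] --> 0%E)).
Proof.
move=> G.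
have b20 : 0 < b2 by exact: lt_trans b1_lt_b2.
have [p0 p00 tailW] := winsorized_stat_tail m_gt2 b1_gt0 b20.
have [V V0 tailG] := gaussian_tail R.
pose N k : R := (s k)%:R; pose L k : R := ln (d (s k))%:R.
pose h k := eta (s k); pose ell k := L k + ln (N k).
pose mu k := mean (P (s k)) (X (s k) 1%N).
have N_ge1 k : 1 <= N k by rewrite ler1n.
have N_gt0 k : 0 < N k by exact: lt_le_trans ltr01 (N_ge1 k).
have L_ge k : ln 2 <= L k by rewrite ler_ln ?posrE ?ltr0n // ler_nat.
have L_gt0 k : 0 < L k by apply: lt_le_trans (L_ge k); rewrite ln_gt0 // ltr1n.
have h_ge0 k : 0 <= h k by have /andP[] := eta_bounds (s k).
have s_ge k : (k <= s k)%N.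
  by elim: k => // k ih; apply: leq_ltn_trans ih (s_incr _ _ (ltnSn k)).
have N_dvg M : \forall k \near \oo, M <= N k.
  have := nbhs_infty_ger M; apply: filterS => k /le_trans; apply.
  by rewrite ler_nat.
have lnE k : ln (d (s k) * s k)%:R = ell k.
  by rewrite natrM lnM ?posrE ?ltr0n.
have lnE' k : ln (d (s k) ^ 2 * s k)%:R = L k + ell k.
  by rewrite natrM natrX lnM ?posrE ?exprn_gt0 ?ltr0n // lnXn ?ltr0n // addrA.
have ell_gt0 k : 0 < ell k by rewrite ltr_wpDr ?ln_ge0.
pose e k := eps lam1 lam2 (h k) (d (s k)) (s k).
pose e' k := eps' lam1' lam2' (h k) (d (s k)) (s k).
have lam1_gt0 : 0 < lam1 by exact: lt_trans lam1_gt1.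
have lam1'_gt0 : 0 < lam1' by exact: lt_trans lam1'_gt1.
have lam2'2_gt0 : 0 < 2 * lam2' by rewrite mulr_gt0.
have eE k : e k = lam1 * h k + lam2 * (ell k / N k) by rewrite /e /eps lnE.
have e_gt0 k : 0 < e k.
  rewrite eE; apply: ltr_wpDl; first by rewrite mulr_ge0 // ltW.
  by rewrite mulr_gt0 // divr_gt0.
have x_gt0 k : 0 < (L k + ell k) / (s k)%:R.
  by apply: divr_gt0; [exact: addr_gt0|exact: N_gt0].
have e'_ge k : lam1' * h k <= e' k.
  rewrite /e' /eps' lnE' lerDl ltW //.
  by rewrite mulr_gt0.
have e'_gt0 k : 0 < e' k.
  rewrite /e' /eps' lnE'; apply: ltr_wpDl; first by rewrite mulr_ge0 // ltW.
  by rewrite mulr_gt0.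
(* Since log(d ^ 2 n) = L + ell <= 2 ell, the level e' is covered by the rate lemmas with 2
   lam2'. *)
have e'_le k : e' k <= lam1' * h k + (2 * lam2') * (ell k / N k).
  rewrite /e' /eps' lnE' lerD2l [2 * _]mulrC -mulrA ler_wpM2l ?(ltW lam2'_gt0) //.
  rewrite mulrA ler_pM2r ?invr_gt0 ?ltr0n // /ell.
  by have := ln_ge0 (N_ge1 k); clear; lra.
(* Each level is at least its [lam1] or [lam1'] times eta, so eta is at most the inverse multiple of
   the level; [kap] is the smaller margin. *)
pose kap := Num.min (1 - lam1^-1) (1 - lam1'^-1).
have kap01 : 0 < kap <= 1.
  have a1 : lam1^-1 < 1 by rewrite invf_lt1.
  have a2 : lam1'^-1 < 1 by rewrite invf_lt1.
  have a3 : 0 < lam1^-1 by rewrite invr_gt0.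
  rewrite /kap lt_min ge_min !subr_gt0 a1 a2 /=.
  by rewrite gerBl (ltW a3).
have kape k : kap * e k <= e k - h k.
  apply: (@le_trans _ _ ((1 - lam1^-1) * e k)).
    by rewrite ler_pM2r // /kap ge_min lexx.
  rewrite mulrBl mul1r lerD2l lerN2 mulrC ler_pdivlMr // mulrC eE.
  by rewrite lerDl mulr_ge0 ?divr_ge0 // ltW.
have kape' k : kap * e' k <= e' k - h k.
  apply: (@le_trans _ _ ((1 - lam1'^-1) * e' k)).
    by rewrite ler_pM2r // /kap ge_min lexx orbT.
  by rewrite mulrBl mul1r lerD2l lerN2 mulrC ler_pdivlMr // mulrC.
have rateE k : rate (s k) (d (s k)) m (h k) =
    h k `^ (1 - 2 / m) + (ell k / N k) `^ (1 - (Num.min (m / 2) 2)^-1).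
  by rewrite /rate lnE.
have [c0 c00 mu_far] := cvge_gt_near c_gt0 cond_mu.
have signal M : 0 < M -> \forall k \near \oo,
    M * Num.sqrt (L k) <= Num.sqrt (N k) * `|mu k|.
  move: M; apply: (@signal_dominates R N L h m m_gt2 N_ge1 L_ge N_dvg
    cond_eta cond_d (fun k => `|mu k|) c0 (fun k => normr_ge0 (mu k)) c00).
  by apply: filterS mu_far => k; rewrite rateE.
have [C Crad] := Hs_radius.
(* [C] may be negative; its positive part keeps the box radius nonnegative. *)
pose C0 := Num.max C 0.
have C00 : 0 <= C0 by rewrite le_max lexx orbT.
have l0 : 0 < Num.sqrt (ln 2 : R) by rewrite sqrtr_gt0 ln_gt0 // ltr1n.
have sL k : Num.sqrt (ln 2) <= Num.sqrt (L k) by rewrite ler_wsqrtr.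
(* Bounds every coordinate's standard deviation, through x ^ 2 <= 1 + |x| ^ m and the moment
   bound. *)
pose sdmax := Num.sqrt (1 + b2 `^ m).
have sdmax0 : 0 < sdmax by rewrite sqrtr_gt0 ltr_wpDr ?powR_ge0.
(* [H] is quantified after the index: the eventual conditions do not depend on it, as the supremum
   requires. *)
have main eps0 : 0 < eps0 -> \forall k \near \oo, forall H, Hs (s k) H ->
    (P (s k) [set w | H (vec (SW (s k) w))] <= eps0%:E)%E /\
    (P (s k) [set w | H (G (s k) w)] <= eps0%:E)%E.
  move=> eps00; pose B := b2 `^ m; have B0 : 0 <= B by exact: powR_ge0.
  (* As K >= 1, the two terms in K sum to at most (1 + 2 B) / K <= eps0 / 2; the other half is left
     for 4 / (n p0 ^ 2). *)
  pose x := (1 + 2 * B) / (eps0 / 2); have e2 : 0 < eps0 / 2 by rewrite divr_gt0.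
  have x0 : 0 <= x by rewrite divr_ge0 ?(ltW e2) // addr_ge0 ?mulr_ge0.
  pose K := 1 + x; have K1 : 1 <= K by rewrite lerDl.
  have K0 : 0 < K by exact: lt_le_trans ltr01 K1.
  have PK : B / K + (1 + B) / K ^+ 2 <= eps0 / 2.
    have h1 : (1 + 2 * B) / K <= eps0 / 2.
      rewrite ler_pdivrMr // [leRHS]mulrC -ler_pdivrMr // -/x.
      by rewrite /K lerDr.
    apply: le_trans h1.
    have -> : (1 + 2 * B) / K = B / K + (1 + B) / K by field; rewrite gt_eqF.
    rewrite lerD2l ler_wpM2l ?addr_ge0 // lef_pV2 ?posrE ?exprn_gt0 //.
    by rewrite expr2 ler_peMl // ltW.
  pose cK := (K + 1) / kap.
  have kap0 : 0 < kap by case/andP: kap01.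
  have cK0 : 0 < cK by rewrite divr_gt0 // addr_gt0.
  pose A := Num.sqrt (3 * cK + 1 + K); have A0 : 0 <= A by exact: sqrtr_ge0.
  pose Bk := 6 * cK `^ m^-1 + K.
  have Bk0 : 0 < Bk by rewrite ltr_wpDl // mulr_ge0 // powR_ge0.
  (* Makes V / t ^ 2 <= eps0; the summand 1 keeps [t] positive if V = 0. *)
  pose t := Num.sqrt (V / eps0) + 1.
  have t0 : 0 < t by rewrite ltr_wpDl // sqrtr_ge0.
  have tV : V / t ^+ 2 <= eps0.
    rewrite ler_pdivrMr ?exprn_gt0 // mulrC -ler_pdivrMr //.
    have Ve : 0 <= V / eps0 by rewrite divr_ge0 // ltW.
    rewrite -[leLHS](sqr_sqrtr Ve) ler_sqr ?nnegrE ?sqrtr_ge0 ?(ltW t0) //.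
    by rewrite lerDl.
  (* Multiplied by sqrt L, the first term is rho A and the second at least K + 2: K for the
     fluctuation, 1 for the winsorization error, 1 for strictness. *)
  have M10 : 0 < C0 * A + (K + 2) / Num.sqrt (ln 2).
    by rewrite ltr_wpDl ?mulr_ge0 // divr_gt0 // addr_gt0.
  (* Multiplied by sqrt L, this is at least sdmax (t + rho). *)
  have M20 : 0 < sdmax * (t / Num.sqrt (ln 2) + C0).
    by rewrite mulr_gt0 // ltr_wpDr // divr_gt0.
  have e4 : 0 < (4^-1 : R) by [].
  (* 1/4 keeps e' below 1/2, and p0 / 12 gives 6 e' <= p0 / 2 < p0. *)
  have p4 : 0 < Num.min (4^-1) (p0 / 12) by rewrite lt_min e4 divr_gt0.
  have F_e : \forall k \near \oo, e k <= 4^-1.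
    have := level_small m_gt2 N_ge1 L_ge h_ge0 N_dvg cond_eta cond_d
      lam1_gt0 lam2_gt0 e4.
    by apply: filterS => k; rewrite eE.
  have F_e' : \forall k \near \oo, e' k <= Num.min (4^-1) (p0 / 12).
    have := level_small m_gt2 N_ge1 L_ge h_ge0 N_dvg cond_eta cond_d
      lam1'_gt0 lam2'2_gt0 p4.
    by apply: filterS => k; exact: le_trans (e'_le k).
  have Bk1 : 0 < Bk^-1 by rewrite invr_gt0.
  have F_sq : \forall k \near \oo, Num.sqrt (N k) * e k `^ (1 - 1 / m) <= Bk^-1.
    have := sqrt_level_small m_gt2 N_ge1 L_ge h_ge0 N_dvg cond_eta cond_d
      lam1_gt0 lam2_gt0 Bk1.
    by apply: filterS => k; rewrite eE.
  have F_N := N_dvg (4 / (eps0 / 2 * p0 ^+ 2)).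
  have S1 := signal _ M10; have S2 := signal _ M20.
  near=> k => H HH.
  have Hr : hyperrectangle H by exact: Hs_sub HH.
  (* The maximizing coordinate may change with the index; all constants above were fixed before
     it. *)
  have [j jE] := cV_norm_attained (mu k) (d_gt0 (s k)).
  pose rho := C0 * Num.sqrt (L k).
  have Hrho x' : H x' -> `|x' j 0| <= rho.
    move=> Hx; apply: le_trans (cV_norm_ge x' j) _.
    have : (`|x'|%:E <= (C * Num.sqrt (L k))%:E)%E.
      have : (ereal_sup [set `|x|%:E | x in \bigcup_(H in Hs (s k)) H]
          <= (C * Num.sqrt (L k))%:E)%E by near: k.
      apply: le_trans; apply: ereal_sup_ubound; exists x' => //.
      by exists H.
    rewrite lee_fin => /le_trans; apply.
    by rewrite ler_wpM2r ?sqrtr_ge0 // le_max lexx.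
  have [iidX mom [sd_ge mom_le] gZ _] := P_in _ (s_gt0 k) _ (s_gt0 k).
  have ek4 : e k <= 4^-1 by near: k.
  have e'k : e' k <= Num.min (4^-1) (p0 / 12) by near: k.
  have e01 : 0 < e k < 1 / 2.
    by rewrite e_gt0; move: ek4; clear; lra.
  have e'01 : 0 < e' k < 1 / 2.
    by rewrite e'_gt0; move: e'k; rewrite le_min => /andP[+ _]; clear; lra.
  have e'p : 6 * e' k < p0.
    by move: e'k; rewrite le_min => /andP[_]; move: p00; clear; lra.
  have sq1 : Bk * (Num.sqrt (N k) * e k `^ (1 - 1 / m)) <= 1.
    have : Num.sqrt (N k) * e k `^ (1 - 1 / m) <= Bk^-1 by near: k.
    by rewrite -(ler_pM2l Bk0) divff // gt_eqF.
  have sig1 : (C0 * A + (K + 2) / Num.sqrt (ln 2)) * Num.sqrt (L k) <=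
      Num.sqrt (N k) * `|mu k| by near: k.
  have sig2 : sdmax * (t / Num.sqrt (ln 2) + C0) * Num.sqrt (L k) <=
      Num.sqrt (N k) * `|mu k| by near: k.
  have sd_gt0 i : 0 < cmoment (P (s k)) (X (s k) 1%N) 2 i.
    exact: lt_le_trans (sd_ge i).
  have lL y : 0 <= y -> y <= y / Num.sqrt (ln 2) * Num.sqrt (L k).
    move=> y0; rewrite -mulrA ler_peMr // mulrC ler_pdivlMr // mul1r.
    exact: sL.
  split.
    have bound : rho * Num.sqrt (3 * ((K + 1) / kap) + 1 + K) <
      Num.sqrt (s k)%:R * `|mean (P (s k)) (X (s k) 1%N) j 0| - K -
      (6 * ((K + 1) / kap) `^ m^-1 + K) *
      (Num.sqrt (s k)%:R * e k `^ (1 - 1 / m)).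
      rewrite -/cK -/Bk -/A -/(mu k) -/(N k) -jE.
      have K2 : 0 <= K + 2 by rewrite addr_ge0 // ltW.
      move: sig1 sq1 (lL _ K2); rewrite /rho mulrDl.
      rewrite (mulrAC C0 A); clear; lra.
    have := tailW _ _ (P (s k)) (s k) (d (s k)) (X (s k)) (Xt (s k)) (SW (s k)) j
      (e k) (e' k) (h k) kap K rho H (s_gt0 k) iidX (contamination _ (s_gt0 k))
      (mom j) (sd_ge j) (mom_le j) (SW_def _ (s_gt0 k) e01 e'01) e01 e'01 e'p
      kap01 (h_ge0 k) (kape k) (kape' k) K0 Hr Hrho bound.
    move=> /le_trans; apply; rewrite lee_fin (splitr eps0) lerD //.
    have Nk : 4 / (eps0 / 2 * p0 ^+ 2) <= N k by near: k.
    have p02 : 0 < p0 ^+ 2 by rewrite exprn_gt0.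
    rewrite ler_pdivrMr ?mulr_gt0 ?ltr0n //; move: Nk.
    by rewrite ler_pdivrMr ?mulr_gt0 // mulrCA.
  have sd_le : cmoment (P (s k)) (X (s k) 1%N) 2 j <= sdmax.
    rewrite cmoment2E ler_wsqrtr //.
    have mD : measurable_fun [set: Omega]
        (fun w => tnth (X (s k) 1%N w) j - mean (P (s k)) (X (s k) 1%N) j 0).
      by apply: measurable_funB => //; exact: measurable_coord.
    have mI : (P (s k)).-integrable [set: Omega] (EFin \o (fun w =>
        `|tnth (X (s k) 1%N w) j - mean (P (s k)) (X (s k) 1%N) j 0| `^ m)).
      apply: intg_powR_shift; [by move: m_gt2; clear; lra|exact: measurable_coord|].
      exact: moment_intg (mom j).
    apply: le_trans (Ex_sqr_le_powR (ltW m_gt2) mD mI) _.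
    by rewrite lerD2l; exact: (cmoment_le m_gt2 (ltW b20) (mom_le j)).
  have boundG : t + rho <=
      Num.sqrt (s k)%:R * `|mean (P (s k)) (X (s k) 1%N) j 0| / sdmax.
    rewrite -/(mu k) -/(N k) -jE ler_pdivlMr // mulrC.
    apply: le_trans sig2; rewrite -mulrA ler_pM2l // mulrDl lerD2r.
    exact: lL (ltW t0).
  have := tailG _ _ (P (s k)) (d (s k)) (X (s k) 1%N) (Z (d (s k))) (s k) j sdmax rho t H
    gZ sd_gt0 sd_le Hr Hrho t0 boundG.
  by move=> /le_trans; apply; rewrite lee_fin.
have P_cvg0 (F : forall k, set Omega) :
    (forall eps0 : R, 0 < eps0 -> \forall k \near \oo, (P (s k) (F k) <= eps0%:E)%E) ->
    P (s k) (F k) @[k --> \oo] --> 0%E.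
  by apply: cvge0_le => k; exact: measure_ge0.
split.
  apply: cvge0_le => [k|eps0 eps00].
    (* The supremum over an empty family would be -oo; a member of [Hs] makes it nonnegative. *)
    have [H HH] := Hs_neq0 k.
    apply: (@le_trans _ _ `|P (s k) [set w | H (vec (SW (s k) w))]
                    - P (s k) [set w | H (G (s k) w)]|%E); first exact: abse_ge0.
    by apply: ereal_sup_ubound; exists H.
  have e2 : 0 < eps0 / 2 by rewrite divr_gt0.
  apply: filterS (main _ e2) => k hk.
  apply: ge_ereal_sup => _ [H HH <-]; have [h1 h2] := hk H HH.
  apply: le_trans (lee_abs_sub _ _) _.
  rewrite !gee0_abs ?measure_ge0 // (splitr eps0) EFinD.
  exact: leeD.
move=> H HH; split; apply: P_cvg0 => eps0 eps00; apply: filterS (main _ eps00) => k hk.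
  by have [] := hk _ (HH k).
by have [] := hk _ (HH k).
Unshelve. all: by end_near.
Qed.
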